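(* Let $n\ge 1$ and let $$\Theta=f_1(\underline z,w)\,dz_1+\cdots+f_n(\underline z,w)\,dz_n+g(\underline z,w)\,dw,\qquad f_1,\ldots,f_n,g\in\mathbb C\{\underline z,w\},$$ be a germ at $(\underline 0,0)\in\mathbb C^{n+1}$ of a not identically vanishing holomorphic $1$-form satisfying the integrability condition $\Theta\wedge d\Theta=0$, and let $\mathcal F$ be the germ of codimension one singular foliation it defines. Assume that the linear part of $\Theta$ is not tangent to the radial vector field. Then there exist local analytic coordinates $(\underline z,w)$ at the origin in which the foliation $\mathcal F$ is defined by $$\widetilde\Theta=df_0+w\,df_1+w\,dw$$ where $f_0,f_1\in\mathbb C\{\underline z\}$ satisfy $df_0\wedge df_1=0$.
   Context: The coordinates on $\mathbb C^{n+1}$ are $(\underline z,w)$ with $\underline z=(z_1,\ldots,z_n)$. $\mathbb C\{\underline z,w\}$ and $\mathbb C\{\underline z\}$ denote rings of convergent power series at the origin. An integrable $1$-form $\Theta\not\equiv0$ defines a singular foliation whose leaves are tangent to $\ker\Theta$; after dividing the coefficients by a common factor, the zero set has codimension at least $2$ and the foliation is regular outside it. Two not identically vanishing integrable $1$-forms define the same foliation if they differ by multiplication by a not identically zero germ of meromorphic function. The linear part $\Theta_1$ of $\Theta$ is the $1$-form whose coefficients are the degree-one homogeneous parts of the coefficients of $\Theta$. The radial vector field is $R=z_1\partial_{z_1}+\cdots+z_n\partial_{z_n}+w\partial_w$. That $\Theta_1$ is not tangent to $R$ means that the contraction $\Theta_1(R)$ is not identically zero. *)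

(* Defs.v *)
(* The field of complex numbers is [R[i]] for [R : realType].
   mpoly has to be imported before esum, otherwise their notations clash. *)
From mathcomp Require Import all_boot all_order all_algebra.
From mathcomp Require Import mpoly.
From mathcomp Require Import complex classical_sets reals constructive_ereal.
From mathcomp Require Import esum.

Set Implicit Arguments.
Unset Strict Implicit.
Unset Printing Implicit Defensive.

Import Order.TTheory GRing.Theory Num.Theory.

Local Open Scope ring_scope.

(* A power series in N variables is its family of coefficients.  All operations
   below are those of the ring of formal power series; the ring of convergent
   power series is the part cut out by [convergent]. *)
Definition series (R : realType) (N : nat) : Type := 'X_{1..N} -> R[i].

Section Series.
Variables (R : realType).
Implicit Types (N K : nat).

(* Absolute convergence on a closed polydisc of positive radius. *)
Definition convergent N (a : series R N) : Prop :=
  exists2 r : R, 0 < r &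
    summable setT (fun m : 'X_{1..N} => (Normc.normc (a m) * r ^+ mdeg m)%:E).

Definition szero N : series R N := fun=> 0.

Definition sadd N (a b : series R N) : series R N := fun m => a m + b m.

Definition ssub N (a b : series R N) : series R N := fun m => a m - b m.

Definition ssum N K (F : 'I_K -> series R N) : series R N :=
  fun m => \sum_(i < K) F i m.

Definition svar N (i : 'I_N) : series R N := fun m => (m == U_(i)%MM)%:R.

Definition trunc N (d : nat) (a : series R N) : {mpoly R[i][N]} :=
  \sum_(m : 'X_{1..N < d.+1}) a m *: 'X_[m].

(* The coefficient at [m] of a product, or of a substitution of series without
   constant term, only involves terms of degree at most [mdeg m]. *)
Definition smul N (a b : series R N) : series R N :=
  fun m => (trunc (mdeg m) a * trunc (mdeg m) b)@_m.

(* [scomp a Phi] is a(Phi_0, ..., Phi_(N-1)); meaningful only when every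
   [Phi i] has zero constant term. *)
Definition scomp N K (a : series R N) (Phi : 'I_N -> series R K) : series R K :=
  fun m => (trunc (mdeg m) a \mPo [tuple trunc (mdeg m) (Phi i) | i < N])@_m.

Definition sder N (i : 'I_N) (a : series R N) : series R N :=
  fun m => a (m + U_(i))%MM *+ (m i).+1.

Definition linear_part N (a : series R N) : series R N :=
  fun m => if mdeg m == 1%N then a m else 0.

End Series.

Arguments szero : clear implicits.
Arguments svar : clear implicits.

(* The 1-form sum_i (theta i) dx_i, and the vector field sum_i (X i) d/dx_i. *)
Definition oneform (R : realType) (N : nat) : Type := 'I_N -> series R N.
Definition vfield (R : realType) (N : nat) : Type := 'I_N -> series R N.

Section Forms.
Variables (R : realType).
Implicit Types (N : nat).

Definition not_identically_zero N (theta : oneform R N) : Prop :=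
  ~ (forall i, theta i =1 szero R N).

Definition dfun N (a : series R N) : oneform R N := fun i => sder i a.

(* 2-forms are antisymmetric families (eta j k), standing for
   sum_(j < k) (eta j k) dx_j /\ dx_k; similarly for 3-forms. *)
Definition dform N (theta : oneform R N) (j k : 'I_N) : series R N :=
  ssub (sder j (theta k)) (sder k (theta j)).

Definition wedge11 N (alpha beta : oneform R N) (j k : 'I_N) : series R N :=
  ssub (smul (alpha j) (beta k)) (smul (alpha k) (beta j)).

Definition wedge12 N (theta : oneform R N) (eta : 'I_N -> 'I_N -> series R N)
    (i j k : 'I_N) : series R N :=
  sadd (smul (theta i) (eta j k))
    (sadd (smul (theta j) (eta k i)) (smul (theta k) (eta i j))).

Definition integrable_form N (theta : oneform R N) : Prop :=
  forall i j k, wedge12 theta (dform theta) i j k =1 szero R N.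

Definition contract N (theta : oneform R N) (X : vfield R N) : series R N :=
  ssum (fun i => smul (theta i) (X i)).

Definition radial N : vfield R N := svar R N.

Definition form_linear_part N (theta : oneform R N) : oneform R N :=
  fun i => linear_part (theta i).

(* Equality up to multiplication by a nonzero meromorphic germ h = b / a,
   i.e. theta = h eta, with the denominator cleared. *)
Definition same_foliation N (theta eta : oneform R N) : Prop :=
  exists a b : series R N,
    [/\ convergent a, convergent b, ~ (a =1 szero R N), ~ (b =1 szero R N)
      & forall i, smul a (theta i) =1 smul b (eta i)].

Definition pullback N (Phi : 'I_N -> series R N) (theta : oneform R N) :
    oneform R N :=
  fun j => ssum (fun i => smul (scomp (theta i) Phi) (sder j (Phi i))).

(* Germs of holomorphic maps (C^N, 0) -> (C^N, 0). *)
Definition germ_map N (Phi : 'I_N -> series R N) : Prop :=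
  forall i, convergent (Phi i) /\ Phi i 0%MM = 0.

(* Germs of biholomorphisms (C^N, 0) -> (C^N, 0), i.e. changes of local
   analytic coordinates at the origin. *)
Definition germ_biholomorphism N (Phi : 'I_N -> series R N) : Prop :=
  germ_map Phi /\
  exists2 Psi : 'I_N -> series R N, germ_map Psi &
    (forall i, scomp (Phi i) Psi =1 svar R N i) /\
    (forall i, scomp (Psi i) Phi =1 svar R N i).

(* On C^(n+1) the last coordinate is w, and z_1, ..., z_n are the others. *)
Definition wvar n : series R n.+1 := svar R n.+1 ord_max.
Arguments wvar : clear implicits.

(* A series in z seen as a series in (z, w). *)
Definition of_z n (a : series R n) : series R n.+1 :=
  scomp a (fun i => svar R n.+1 (widen_ord (leqnSn n) i)).

Definition normal_form n (f0 f1 : series R n) : oneform R n.+1 :=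
  fun i => sadd (dfun (of_z f0) i)
    (sadd (smul (wvar n) (dfun (of_z f1) i)) (smul (wvar n) (dfun (wvar n) i))).

End Forms.

Arguments radial : clear implicits.
Arguments wvar : clear implicits.

(* Main.v *)
(** Near a point where [theta = sum f_i dz_i + g dw] is tangent to the [w]-line to
    first order one may take [g] itself as the coordinate [w] and divide by a unit,
    so that the form becomes [theta = w dw + sum F_i dz_i].  Put [f = sum z_i F_i] and
    let [E = sum z_i d/dz_i].  The whole proof rests on one scalar equation: look for
    a new coordinate [psi = w v] such that the radial contraction of the transformed
    form is [A(z) + B(z) psi], affine in [psi].  This amounts to
    [w^2 E v = f (w v)' - A / v - B w] (prime is [d/dw]), in which [A] and [B] are
    determined by requiring that the right-hand side be divisible by [w^2]; with
    [v = 1] on [z = 0] it has a unique formal solution.  It loses one derivative and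
    two powers of [w], but [E] gains a factor (degree in [z]); in the weighted l1 norm
    with weights [e^k s^j / binomial(3k + j, k)] on the monomials of degree [k] in
    [z] and [j] in [w], which is submultiplicative, gains and losses cancel, so that
    the iteration preserves a ball and its formal limit converges.

    Contracting the integrability condition with the radial field of the [z]-space
    gives a linear equation for each coefficient of the new form, which forces its
    second derivative in the last coordinate to vanish.  So the form is
    [alpha + w beta + w dw] with [alpha], [beta] in the variables [z], and its
    integrability says precisely that [alpha] and [beta] are closed and that
    [alpha /\ beta = 0]. *)
Require Import Defs.
From HB Require Import structures.
From mathcomp Require Import all_boot all_order all_algebra.
From mathcomp Require Import perm mpoly.
From mathcomp Require Import complex boolp classical_sets cardinality fsbigop.
From mathcomp Require Import reals constructive_ereal ereal esum ring lra zify.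
(* Imported again because constructive_ereal has a [contract] of its own. *)
Require Import Defs.

Set Implicit Arguments.
Unset Strict Implicit.
Unset Printing Implicit Defensive.

Import Order.TTheory GRing.Theory Num.Theory.

Local Open Scope ring_scope.

(** Origin of the scalar equation: multiplication by v psi' turns the dw-coefficient w into psi
    psi'. In the coordinates (z, psi) the form becomes psi dpsi plus dz-terms whose contraction with
    E is v psi' f - psi E psi. Equating this with A + B psi and dividing by v gives the equation,
    because E(w v) = w E v. So one unknown function is solved for, and the n separate coefficients
    are left to integrability.

    Obstacle: the derivative in w and the division by w^2 are unbounded in the norm of any single
    polydisc. The way out is that f vanishes on z = 0, so every application of the right-hand side
    raises the degree k in z. This dictates the 3 in binomial(3k + j, k). Raising k by one raises 3k
    + j by three; two of these pay for the division by w^2, and the third pays for the derivative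
    through (N+1) binomial(N, k) = (k+1) binomial(N+1, k+1), the factor k+1 being supplied by the
    inverse of E. *)

Local Notation normc := Normc.normc.

(** * The ring of power series *)

(* The operations are sealed because deciding that two distinct products (or
   substitutions) of series are not convertible is intractable. *)
HB.lock Definition sprod (R : realType) (N : nat) (a b : series R N) : series R N :=
  smul a b.
HB.lock Definition spder (R : realType) (N : nat) (i : 'I_N) (a : series R N) :
  series R N := sder i a.
HB.lock Definition ssubst (R : realType) (N K : nat) (a : series R N)
  (Phi : 'I_N -> series R K) : series R K := scomp a Phi.

Lemma smul_def (R : realType) (N : nat) : @smul R N = @sprod R N.
Proof. by rewrite sprod.unlock. Qed.
Lemma sder_def (R : realType) (N : nat) : @sder R N = @spder R N.
Proof. by rewrite spder.unlock. Qed.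
Lemma scomp_def (R : realType) (N K : nat) : @scomp R N K = @ssubst R N K.
Proof. by rewrite ssubst.unlock. Qed.

Section SeriesRing.
Variables (R : realType) (N : nat).
Local Notation C := R[i].
Local Notation S := (series R N).
Implicit Types (a b : S) (m : 'X_{1..N}) (p q : {mpoly C[N]}).

Lemma mcoeff_trunc d a m : (trunc d a)@_m = if (mdeg m <= d)%N then a m else 0.
Proof.
case: leqP => h; first by rewrite /trunc mcoeff_mpoly.
rewrite /trunc raddf_sum big1 //= => k _.
rewrite mcoeffZ mcoeffX; case: eqP => [e|]; last by rewrite mulr0.
by have := bmdeg k; rewrite e ltnS leqNgt h.
Qed.

(** Congruence modulo the monomials of degree above [d]. Products and substitutions of series are
    read off truncations, so their laws are transported from polynomials along this relation. *)
Definition mpoly_eq_upto d p q := forall m, (mdeg m <= d)%N -> p@_m = q@_m.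

Lemma mpoly_eq_uptoM d p p' q q' : mpoly_eq_upto d p p' -> mpoly_eq_upto d q q' ->
  mpoly_eq_upto d (p * q) (p' * q').
Proof.
move=> hp hq m hm; rewrite !mcoeffM; apply: eq_bigr => -[k1 k2] /= _.
by rewrite hp ?hq //; apply: leq_trans hm; rewrite -ltnS; apply: bmdeg.
Qed.

Lemma trunc_eq_upto d p a : (forall m, (mdeg m <= d)%N -> p@_m = a m) ->
  mpoly_eq_upto d (trunc d a) p.
Proof. by move=> h m hm; rewrite mcoeff_trunc hm h. Qed.

Lemma smulE d a b m : (mdeg m <= d)%N -> smul a b m = (trunc d a * trunc d b)@_m.
Proof.
move=> hm; apply: mpoly_eq_uptoM (leqnn _) => k hk;
by rewrite !mcoeff_trunc hk (leq_trans hk hm).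
Qed.

Definition scst (c : C) : S := fun m => if m == 0%MM then c else 0.

Lemma trunc_scst d (c : C) : trunc d (scst c) = c%:MP.
Proof.
apply/mpolyP => m; rewrite mcoeff_trunc mcoeffC /scst.
case: eqP => [->|_]; first by rewrite mdeg0 mulr1.
by rewrite mulr0 if_same.
Qed.

Lemma saddA : associative (@sadd R N).
Proof. by move=> a b c; apply/funext => m; rewrite /sadd addrA. Qed.
Lemma saddC : commutative (@sadd R N).
Proof. by move=> a b; apply/funext => m; rewrite /sadd addrC. Qed.
Lemma sadd0 : left_id (szero R N) (@sadd R N).
Proof. by move=> a; apply/funext => m; rewrite /sadd add0r. Qed.
Lemma saddN : left_inverse (szero R N) (fun a m => - a m) (@sadd R N).
Proof. by move=> a; apply/funext => m; rewrite /sadd addNr. Qed.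

HB.instance Definition _ := gen_eqMixin S.
HB.instance Definition _ := gen_choiceMixin S.
HB.instance Definition _ := GRing.isZmodule.Build S saddA saddC sadd0 saddN.

Lemma smulA : associative (@smul R N).
Proof.
move=> a b c; apply/funext => m; pose d := mdeg m.
rewrite /smul -/d (@mpoly_eq_uptoM d _ (trunc d a) _ (trunc d b * trunc d c)) //.
  rewrite mulrA; symmetry; apply: mpoly_eq_uptoM (leqnn _) => //.
  by apply: trunc_eq_upto => k hk; rewrite -/(smul a b k) (smulE _ _ hk).
by apply: trunc_eq_upto => k hk; rewrite -/(smul b c k) (smulE _ _ hk).
Qed.
Lemma smulC : commutative (@smul R N).
Proof. by move=> a b; apply/funext => m; rewrite /smul mulrC. Qed.
Lemma smul1 : left_id (scst 1) (@smul R N).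
Proof.
move=> a; apply/funext => m.
by rewrite /smul trunc_scst mpolyC1 mul1r mcoeff_trunc leqnn.
Qed.
Lemma trunc_sadd d a b : trunc d (sadd a b) = trunc d a + trunc d b.
Proof.
by apply/mpolyP => m; rewrite mcoeffD !mcoeff_trunc; case: ifP; rewrite ?addr0.
Qed.
Lemma smulDl : left_distributive (@smul R N) (@sadd R N).
Proof.
by move=> a b c; apply/funext => m; rewrite /smul trunc_sadd mulrDl mcoeffD.
Qed.
Lemma scst10 : scst 1 != 0 :> S.
Proof.
by apply/eqP => /(congr1 (@^~ 0%MM)); rewrite /scst eqxx => /eqP; rewrite oner_eq0.
Qed.

Lemma sprodA : associative (@sprod R N). Proof. by rewrite -smul_def; apply: smulA. Qed.
Lemma sprodC : commutative (@sprod R N). Proof. by rewrite -smul_def; apply: smulC. Qed.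
Lemma sprod1 : left_id (scst 1) (@sprod R N). Proof. by rewrite -smul_def;
  apply: smul1. Qed.
Lemma sprodDl : left_distributive (@sprod R N) (@sadd R N).
Proof. by rewrite -smul_def; apply: smulDl. Qed.

HB.instance Definition _ := GRing.Zmodule_isComNzRing.Build S
  sprodA sprodC sprod1 sprodDl scst10.

Lemma saddE a b m : (a + b) m = a m + b m. Proof. by []. Qed.
Lemma soppE a m : (- a) m = - a m. Proof. by []. Qed.
Lemma ssubE a b m : (a - b) m = a m - b m. Proof. by []. Qed.
Lemma szeroE m : (0 : S) m = 0. Proof. by []. Qed.
Lemma ssum_coef (I : Type) (r : seq I) (P : pred I) (F : I -> S) m :
  (\sum_(i <- r | P i) F i) m = \sum_(i <- r | P i) F i m.
Proof. by apply: (big_morph (fun a : S => a m)). Qed.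
Lemma ssum_def K (F : 'I_K -> S) : ssum F = \sum_i F i.
Proof. by apply/funext => m; rewrite ssum_coef. Qed.

Lemma smul_coef d a b m : (mdeg m <= d)%N ->
  (a * b) m = (trunc d a * trunc d b)@_m.
Proof. by move=> hm; rewrite -(smulE _ _ hm) smul_def. Qed.

Lemma smul_sum d a b m : (mdeg m < d)%N ->
  (a * b) m = \sum_(k : 'X_{1..N < d} * 'X_{1..N < d} | m == (k.1 + k.2)%MM)
                 a k.1 * b k.2.
Proof.
move=> hm; rewrite (@smul_coef d.-1); last by case: d hm.
rewrite (@mcoeff_poly_mul _ _ _ _ _ d) //; apply: eq_bigr => -[k1 k2] /= _.
have h (k : 'X_{1..N < d}) : (mdeg k <= d.-1)%N.
  by rewrite -ltnS prednK ?bmdeg // (leq_ltn_trans _ hm).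
by rewrite !mcoeff_trunc !h.
Qed.

Lemma scst_coef (c : C) m : scst c m = if m == 0%MM then c else 0.
Proof. by []. Qed.
Lemma sone_coef m : (1 : S) m = (m == 0%MM)%:R.
Proof. by rewrite /= -[LHS]/(scst 1 m) /scst; case: eqP. Qed.

Lemma scst_mul_coef (c : C) a m : (scst c * a) m = c * a m.
Proof.
by rewrite (smul_coef _ _ (leqnn _)) trunc_scst mcoeffCM mcoeff_trunc leqnn.
Qed.
Lemma scst0 : scst 0 = 0.
Proof. by apply/funext => m; rewrite scst_coef if_same. Qed.
Lemma scst1 : scst 1 = 1. Proof. by []. Qed.
Lemma scstD (c c' : C) : scst (c + c') = scst c + scst c'.
Proof. by apply/funext => m; rewrite saddE !scst_coef; case: ifP; rewrite ?addr0. Qed.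
Lemma scstM (c c' : C) : scst (c * c') = scst c * scst c'.
Proof.
by apply/funext => m; rewrite scst_mul_coef !scst_coef; case: ifP; rewrite ?mulr0.
Qed.
Lemma scst_nat k : scst k%:R = k%:R.
Proof. by elim: k => [|k ih]; rewrite ?scst0 // -addn1 !natrD scstD ih. Qed.
Lemma smulrn_coef a k m : (a *+ k) m = a m *+ k.
Proof. by elim: k => [|k ih]; rewrite ?mulr0n // !mulrS saddE ih. Qed.

Lemma smul_coef0 a b : (a * b) 0%MM = a 0%MM * b 0%MM.
Proof.
rewrite (@smul_coef 0) ?mdeg0 //.
have h (c : S) : (trunc 0 c) = (c 0%MM)%:MP.
  apply/mpolyP => m; rewrite mcoeff_trunc mcoeffC leqn0 mdeg_eq0.
  by case: eqP => [->|]; rewrite ?mulr1 ?mulr0.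
by rewrite !h -mpolyCM mcoeffC eqxx mulr1.
Qed.

Lemma mnm1_eq (i j : 'I_N) : (U_(i)%MM == U_(j)%MM :> 'X_{1..N}) = (i == j).
Proof.
apply/eqP/eqP => [/mnmP /(_ i)|-> //]; rewrite !mnm1E eqxx.
by case: eqP.
Qed.
Lemma svar_coef i m : svar R N i m = (m == U_(i)%MM)%:R. Proof. by []. Qed.
Lemma svar_coef0 i : svar R N i 0%MM = 0.
Proof. by rewrite svar_coef eq_sym mnm1_eq0. Qed.

Lemma trunc_smul d a b : mpoly_eq_upto d (trunc d (a * b)) (trunc d a * trunc d b).
Proof. by apply: trunc_eq_upto => k hk; rewrite (smul_coef _ _ hk). Qed.

Lemma smulX_coef i a m : (svar R N i * a) (m + U_(i))%MM = a m.
Proof.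
rewrite (smul_coef _ _ (leqnn _)).
have -> : trunc (mdeg (m + U_(i))) (svar R N i) = 'X_i.
  apply/mpolyP => k; rewrite mcoeff_trunc mcoeffX svar_coef eq_sym.
  case: eqP => [<-|_]; last by rewrite if_same.
  by rewrite mdegD mdeg1 leq_addl.
by rewrite mulrC [(m + _)%MM]addmC mcoeffMX mcoeff_trunc mdegD leq_addl.
Qed.

Lemma smulX_coef0 i a m : m i = 0%N -> (svar R N i * a) m = 0.
Proof.
move=> hm; rewrite (smul_sum _ _ (leqnn _)) big1 // => -[k1 k2] /= /eqP e.
rewrite svar_coef; case: eqP => [e1|_]; last by rewrite mul0r.
by move: hm; rewrite {1}e e1 mnmDE mnm1E eqxx.
Qed.

Lemma sder_coef i a m : spder i a m = a (m + U_(i))%MM *+ (m i).+1.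
Proof. by rewrite -sder_def. Qed.
Lemma trunc_sder d i a : trunc d (spder i a) = (trunc d.+1 a)^`M(i).
Proof.
apply/mpolyP => m; rewrite mcoeff_mderiv !mcoeff_trunc sder_coef mdegD mdeg1 addn1 ltnS.
by case: ifP => _; rewrite ?mul0rn.
Qed.
Lemma sderD i a b : spder i (a + b) = spder i a + spder i b.
Proof. by apply/funext => m; rewrite saddE !sder_coef saddE mulrnDl. Qed.
Lemma sderN i a : spder i (- a) = - spder i a.
Proof. by apply/funext => m; rewrite soppE !sder_coef soppE mulNrn. Qed.
Lemma sderB i a b : spder i (a - b) = spder i a - spder i b.
Proof. by rewrite sderD sderN. Qed.
Lemma sder0 i : spder i 0 = 0.
Proof. by apply/funext => m; rewrite sder_coef !szeroE mul0rn. Qed.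
Lemma sder_sum i (I : Type) (r : seq I) (P : pred I) (F : I -> S) :
  spder i (\sum_(j <- r | P j) F j) = \sum_(j <- r | P j) spder i (F j).
Proof. by apply: (big_morph (spder i)) => [x y|]; rewrite ?sderD ?sder0. Qed.
Lemma sderM i a b : spder i (a * b) = spder i a * b + a * spder i b.
Proof.
apply/funext => m; rewrite saddE !(smul_coef _ _ (leqnn _)) !trunc_sder.
have h := mcoeff_mderiv i (trunc (mdeg m).+1 a * trunc (mdeg m).+1 b) m.
rewrite sder_coef (@smul_coef (mdeg m).+1) ?mdegD ?mdeg1 ?addn1 // -h.
rewrite mderivM mcoeffD; congr (_ + _); apply: mpoly_eq_uptoM (leqnn _) => //;
by move=> k hk; rewrite !mcoeff_trunc hk leqW.
Qed.
Lemma sder_scst i (c : C) : spder i (scst c) = 0.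
Proof.
apply/funext => m; rewrite sder_coef scst_coef mnmD_eq0 mnm1_eq0 andbF.
by rewrite mul0rn.
Qed.
Lemma sder_svar i j : spder i (svar R N j) = (i == j)%:R.
Proof.
apply/funext => m; rewrite sder_coef svar_coef -scst_nat scst_coef.
case: (eqVneq i j) => [<-|ne].
  rewrite -{2}[U_(i)%MM]add0m eqm_add2r.
  by case: eqP => [->|] //; rewrite ?mnm0E ?mul0rn.
rewrite if_same; case: eqP => [/(congr1 (fun k : 'X_{1..N} => k i))|_];
  last by rewrite mul0rn.
by rewrite mnmDE !mnm1E eqxx eq_sym (negPf ne) addn1.
Qed.
Lemma sder_comm i j a : spder i (spder j a) = spder j (spder i a).
Proof.
apply/funext => m; rewrite !sder_coef -!mulrnA -!addmA [(U_(i) + _)%MM]addmC.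
congr (_ *+ _); rewrite !mnmDE !mnm1E [j == i]eq_sym.
case: (eqVneq i j) => [->|_] //; by rewrite mulnC !addn0.
Qed.
End SeriesRing.

(** * Substitution and the chain rule *)

Section PolyUpto.
Variables (R : realType) (N : nat).
Local Notation C := R[i].
Implicit Types (p q : {mpoly C[N]}).

Lemma mpoly_eq_upto_trans d p q r : mpoly_eq_upto d p q -> mpoly_eq_upto d q r ->
  mpoly_eq_upto d p r.
Proof. by move=> h1 h2 m hm; rewrite h1 ?h2. Qed.

Lemma mpoly_eq_upto_sum d (I : Type) (r : seq I) (P : pred I) (F G : I ->
  {mpoly C[N]}) :
  (forall i, mpoly_eq_upto d (F i) (G i)) ->
  mpoly_eq_upto d (\sum_(i <- r | P i) F i) (\sum_(i <- r | P i) G i).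
Proof.
by move=> h m hm; rewrite !raddf_sum; apply: eq_bigr => i _ /=; apply: h.
Qed.

Lemma mpoly_eq_upto_prod d (I : Type) (r : seq I) (P : pred I) (F G : I ->
  {mpoly C[N]}) :
  (forall i, mpoly_eq_upto d (F i) (G i)) ->
  mpoly_eq_upto d (\prod_(i <- r | P i) F i) (\prod_(i <- r | P i) G i).
Proof. by move=> h; elim/big_rec2: _ => // i x y _; apply: mpoly_eq_uptoM. Qed.

Lemma mpoly_eq_uptoX d k p q : mpoly_eq_upto d p q -> mpoly_eq_upto d (p ^+ k) (q ^+ k).
Proof.
move=> h; elim: k => [|k ih]; first by rewrite !expr0.
by rewrite !exprS; apply: mpoly_eq_uptoM.
Qed.

Definition mpoly_order d p := forall m, (mdeg m < d)%N -> p@_m = 0.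

Lemma mpoly_orderM d e p q : mpoly_order d p -> mpoly_order e q ->
  mpoly_order (d + e) (p * q).
Proof.
move=> hp hq m hm; rewrite mcoeffM big1 // => -[k1 k2] /= /eqP em.
have hd : (mdeg k1 + mdeg k2 < d + e)%N by rewrite -mdegD -em.
case: (ltnP (mdeg k1) d) => h; first by rewrite hp ?mul0r.
by rewrite hq ?mulr0 //; lia.
Qed.

Lemma mpoly_orderX k p : mpoly_order 1 p -> mpoly_order k (p ^+ k).
Proof.
move=> hp; elim: k => [|k ih]; first by move=> m.
by rewrite exprS -add1n; apply: mpoly_orderM.
Qed.

Lemma mpoly_order_prod (I : Type) (r : seq I) (k : I -> nat) (F : I -> {mpoly C[N]}) :
  (forall i, mpoly_order (k i) (F i)) ->
  mpoly_order (\sum_(i <- r) k i)%N (\prod_(i <- r) F i).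
Proof.
move=> h; elim: r => [|i r ih]; first by move=> m; rewrite big_nil.
by rewrite !big_cons; apply: mpoly_orderM.
Qed.

End PolyUpto.

Section Comp.
Variables (R : realType) (N K : nat).
Local Notation C := R[i].
Implicit Types (a b : series R N) (Phi : 'I_N -> series R K).

Definition order1 Phi := forall i, Phi i 0%MM = 0.

Lemma mpoly_eq_upto_compr d (p : {mpoly C[N]}) (q q' : N.-tuple {mpoly C[K]}) :
  (forall i, mpoly_eq_upto d (tnth q i) (tnth q' i)) ->
  mpoly_eq_upto d (p \mPo q) (p \mPo q').
Proof.
move=> h; rewrite !comp_mpolyE; apply: mpoly_eq_upto_sum => m.
rewrite -!mul_mpolyC; apply: mpoly_eq_uptoM => //.
by apply: mpoly_eq_upto_prod => i; apply: mpoly_eq_uptoX.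
Qed.

(** As [q] has no constant terms, a monomial of degree e turns into a polynomial of order at least
    e; the part of [p] beyond degree [d] never reaches degree [d]. *)
Lemma mpoly_eq_upto_compl d (p p' : {mpoly C[N]}) (q : N.-tuple {mpoly C[K]}) :
  (forall i, (tnth q i)@_0 = 0) -> mpoly_eq_upto d p p' ->
  mpoly_eq_upto d (p \mPo q) (p' \mPo q).
Proof.
move=> h0 h m hm; apply/eqP; rewrite -subr_eq0 -mcoeffB -comp_mpolyB.
rewrite comp_mpolyE raddf_sum /= big1_seq // => k /= hk.
rewrite mcoeffZ; case: (leqP (mdeg k) d) => hkd.
  by rewrite mcoeffB h // subrr mul0r.
have ho : mpoly_order (mdeg k) (\prod_(i < N) tnth q i ^+ k i).
  rewrite mdegE; apply: mpoly_order_prod => i; apply: mpoly_orderX => m' hm'.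
  by have : mdeg m' == 0%N by [case: (mdeg m') hm']; rewrite mdeg_eq0 => /eqP ->.
by rewrite ho ?mulr0 //; apply: leq_ltn_trans hkd.
Qed.

Definition trunc_tuple d Phi := [tuple trunc d (Phi i) | i < N].

Lemma tnth_trunc d Phi i : tnth (trunc_tuple d Phi) i = trunc d (Phi i).
Proof. by rewrite tnth_mktuple. Qed.

Lemma trunc_coef0 L d (a : series R L) : (trunc d a)@_0 = a 0%MM.
Proof. by rewrite mcoeff_trunc mdeg0. Qed.

Lemma mpoly_eq_upto_comp d (p p' : {mpoly C[N]}) (q q' : N.-tuple {mpoly C[K]}) :
  (forall i, (tnth q i)@_0 = 0) -> mpoly_eq_upto d p p' ->
  (forall i, mpoly_eq_upto d (tnth q i) (tnth q' i)) ->
  mpoly_eq_upto d (p \mPo q) (p' \mPo q').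
Proof.
move=> h0 h h'; apply: mpoly_eq_upto_trans (mpoly_eq_upto_compr _ h').
exact: mpoly_eq_upto_compl.
Qed.

Lemma trunc_trunc L d e (a : series R L) : (d <= e)%N ->
  mpoly_eq_upto d (trunc d a) (trunc e a).
Proof. by move=> hde m hm; rewrite !mcoeff_trunc hm (leq_trans hm hde). Qed.

Lemma ssubst_coef a Phi m : ssubst a Phi m = (trunc (mdeg m) a \mPo trunc_tuple (mdeg
  m) Phi)@_m.
Proof. by rewrite -scomp_def. Qed.

Lemma scompE d a Phi m : order1 Phi -> (mdeg m <= d)%N ->
  ssubst a Phi m = (trunc d a \mPo trunc_tuple d Phi)@_m.
Proof.
move=> h0 hm; rewrite ssubst_coef; apply: (@mpoly_eq_upto_comp (mdeg m)) => //.
- by move=> i; rewrite tnth_trunc trunc_coef0.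
- exact: trunc_trunc.
- by move=> i; rewrite !tnth_mktuple; apply: trunc_trunc.
Qed.

Lemma trunc_scomp d a Phi : order1 Phi ->
  mpoly_eq_upto d (trunc d (ssubst a Phi)) (trunc d a \mPo trunc_tuple d Phi).
Proof. by move=> h0; apply: trunc_eq_upto => m hm; rewrite (@scompE d). Qed.

Lemma scompD a b Phi : ssubst (a + b) Phi = ssubst a Phi + ssubst b Phi.
Proof.
by apply/funext => m; rewrite saddE !ssubst_coef (trunc_sadd _ a b : trunc _ (a +
  b) = _) comp_mpolyD mcoeffD.
Qed.

Lemma scomp0 Phi : ssubst 0 Phi = 0.
Proof. by have := scompD 0 0 Phi; rewrite addr0 => /eqP;
  rewrite -[X in X == _]addr0 (inj_eq (addrI _)) => /eqP. Qed.

Lemma scompN a Phi : ssubst (- a) Phi = - ssubst a Phi.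
Proof. by apply/eqP; rewrite -addr_eq0 -scompD addNr scomp0. Qed.

Lemma scompB a b Phi : ssubst (a - b) Phi = ssubst a Phi - ssubst b Phi.
Proof. by rewrite scompD scompN. Qed.

Lemma scomp_sum Phi (I : Type) (r : seq I) (P : pred I) (F : I -> series R N) :
  ssubst (\sum_(j <- r | P j) F j) Phi = \sum_(j <- r | P j) ssubst (F j) Phi.
Proof. by apply: (big_morph (fun a => ssubst a Phi)) => [x y|];
  rewrite ?scompD ?scomp0. Qed.

Lemma scompM a b Phi : order1 Phi -> ssubst (a * b) Phi = ssubst a Phi * ssubst b Phi.
Proof.
move=> h0; apply/funext => m; set d := mdeg m.
rewrite (smul_coef _ _ (leqnn _)) -/d.
transitivity ((trunc d a * trunc d b) \mPo trunc_tuple d Phi)@_m.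
  rewrite ssubst_coef; apply: (@mpoly_eq_upto_compl d) (leqnn _) => [i|];
    first by rewrite tnth_trunc trunc_coef0.
  exact: trunc_smul.
rewrite rmorphM; symmetry; apply: (@mpoly_eq_uptoM R _ d) (leqnn _); exact: trunc_scomp.
Qed.

Lemma scomp_scst c Phi : ssubst (@scst R N c) Phi = scst c.
Proof.
apply/funext => m; rewrite ssubst_coef trunc_scst comp_mpolyC mcoeffC /scst.
by case: eqP; rewrite ?mulr1 ?mulr0.
Qed.

Lemma trunc_svar L d (i : 'I_L) : (0 < d)%N -> trunc d (svar R L i) = 'X_i.
Proof.
move=> hd; apply/mpolyP => k; rewrite mcoeff_trunc mcoeffX svar_coef eq_sym.
by case: eqP => [<-|_]; rewrite ?if_same // mdeg1 hd.
Qed.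

Lemma scomp_svar Phi i : order1 Phi -> ssubst (svar R N i) Phi = Phi i.
Proof.
move=> h0; apply/funext => m; rewrite (@scompE (mdeg m).+1) // trunc_svar //.
by rewrite comp_mpolyXU -tnth_nth tnth_trunc mcoeff_trunc leqnSn.
Qed.

Lemma scomp_coef0 a Phi : order1 Phi -> ssubst a Phi 0%MM = a 0%MM.
Proof.
move=> h0; rewrite (@scompE 0) ?mdeg0 //.
have -> : trunc 0 a = (a 0%MM)%:MP.
  apply/mpolyP => m; rewrite mcoeff_trunc mcoeffC leqn0 mdeg_eq0.
  by case: eqP => [->|]; rewrite ?mulr1 ?mulr0.
by rewrite comp_mpolyC mcoeffC eqxx mulr1.
Qed.

Lemma leibniz_sum (A : comPzRingType) (I : finType) (F1 F2 G : I -> A) (x y : A) :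
  (\sum_i F1 i * G i) * y + x * (\sum_i F2 i * G i) =
  \sum_i (F1 i * y + x * F2 i) * G i.
Proof.
rewrite mulr_suml mulr_sumr -big_split; apply: eq_bigr => i _ /=.
by rewrite mulrDl mulrAC mulrA.
Qed.

Section PolyChainRule.
Variables (q : N.-tuple {mpoly C[K]}) (j : 'I_K).

Definition chain_rule (p : {mpoly C[N]}) : Prop :=
  (p \mPo q)^`M(j) = \sum_i (p^`M(i) \mPo q) * (tnth q i)^`M(j).

Lemma chain_ruleD p1 p2 : chain_rule p1 -> chain_rule p2 -> chain_rule (p1 + p2).
Proof.
rewrite /chain_rule => h1 h2; apply: etrans (congr1 _ (comp_mpolyD _ _ _)) _.
apply: etrans (mderivD _ _ _) (etrans (f_equal2 +%R h1 h2) _).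
rewrite -big_split; apply: eq_bigr => i _.
by rewrite mderivD comp_mpolyD mulrDl.
Qed.

Lemma chain_ruleZ c p : chain_rule p -> chain_rule (c *: p).
Proof.
rewrite /chain_rule => h; apply: etrans (congr1 _ (comp_mpolyZ _ _ _)) _.
apply: etrans (mderivZ _ _ _) (etrans (congr1 _ h) _).
rewrite scaler_sumr; apply: eq_bigr => i _.
by rewrite mderivZ comp_mpolyZ scalerAl.
Qed.

Lemma chain_ruleC c : chain_rule c%:MP.
Proof.
rewrite /chain_rule comp_mpolyC mderivC big1 // => i _.
by rewrite mderivC comp_mpoly0 mul0r.
Qed.

Lemma chain_ruleM p1 p2 : chain_rule p1 -> chain_rule p2 -> chain_rule (p1 * p2).
Proof.
rewrite /chain_rule => h1 h2; apply: etrans (congr1 _ (rmorphM (comp_mpoly q) _ _)) _.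
apply: etrans (mderivM _ _ _) _.
apply: etrans (f_equal2 +%R (congr1 (fun x => x * _) h1) (congr1 (fun x =>
  _ * x) h2)) _.
apply: etrans (leibniz_sum _ _ _ _ _) (eq_bigr _ _) => i _.
have e1 := rmorphM (comp_mpoly q) p1^`M(i) p2.
have e2 := rmorphM (comp_mpoly q) p1 p2^`M(i).
have e3 := etrans (congr1 (comp_mpoly q) (mderivM i p1 p2)) (comp_mpolyD _ _ _).
have e4 := esym (etrans e3 (f_equal2 +%R e1 e2)).
by apply: (f_equal2 *%R e4).
Qed.

Lemma chain_ruleXU i : chain_rule 'X_i.
Proof.
rewrite /chain_rule comp_mpolyXU -tnth_nth (bigD1 i) //= big1 => [|k hk].
  rewrite mderivX mnm1E eqxx -[X in (X - _)%MM]add0m addmK mpolyX0 scale1r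
    comp_mpoly1 mul1r.
  by rewrite addr0.
by rewrite mderivX mnm1E eq_sym (negPf hk) scale0r comp_mpoly0 mul0r.
Qed.

Lemma mderiv_comp p : chain_rule p.
Proof.
rewrite [p]mpolyE; elim/big_ind: _ => [||m _].
- by rewrite -mpolyC0; apply: chain_ruleC.
- exact: chain_ruleD.
apply: chain_ruleZ; rewrite mpolyXE_id; elim/big_ind: _ => [||i _].
- by rewrite -mpolyC1; apply: chain_ruleC.
- exact: chain_ruleM.
elim: (m i) => [|k ih]; first by rewrite expr0 -mpolyC1; apply: chain_ruleC.
by rewrite exprS; apply: (chain_ruleM (chain_ruleXU i) ih).
Qed.

End PolyChainRule.

Lemma sder_scomp a Phi j : order1 Phi ->
  spder j (ssubst a Phi) = \sum_i ssubst (spder i a) Phi * spder j (Phi i).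
Proof.
move=> h0; apply/funext => m; rewrite ssum_coef sder_coef; set d := mdeg m.
(* A derivative reads coefficients one degree higher, hence the truncation at [d.+1]. *)
rewrite (@scompE d.+1) ?mdegD ?mdeg1 ?addn1 // -mcoeff_mderiv mderiv_comp raddf_sum.
apply: eq_bigr => i _ /=; rewrite (smul_coef _ _ (leqnn _)) -/d tnth_trunc -!trunc_sder.
apply: (@mpoly_eq_uptoM R _ d) (leqnn _) => //.
apply: mpoly_eq_upto_trans (fun m hm => esym (trunc_scomp _ h0 hm)).
apply: mpoly_eq_upto_compr => k; rewrite !tnth_trunc.
by move=> u hu; rewrite !mcoeff_trunc hu leqW.
Qed.

End Comp.

Section CompComp.
Variables (R : realType).

Lemma comp_mpolyA N K L (p : {mpoly R[i][N]}) (q : N.-tuple {mpoly R[i][K]})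
  (r : K.-tuple {mpoly R[i][L]}) :
  (p \mPo q) \mPo r = p \mPo [tuple (tnth q i) \mPo r | i < N].
Proof.
rewrite !(comp_mpolyE p) raddf_sum /=; apply: eq_bigr => m _.
rewrite comp_mpolyZ rmorph_prod; congr (_ *: _).
by apply: eq_bigr => i _; rewrite rmorphXn tnth_mktuple.
Qed.

Lemma scomp_order1 N K L (Phi : 'I_N -> series R K) (Psi : 'I_K -> series R L) :
  order1 Phi -> order1 Psi -> order1 (fun i => ssubst (Phi i) Psi).
Proof. by move=> h1 h2 i; rewrite scomp_coef0. Qed.

Lemma scompA N K L (a : series R N) (Phi : 'I_N -> series R K) (Psi : 'I_K ->
  series R L) :
  order1 Phi -> order1 Psi ->
  ssubst (ssubst a Phi) Psi = ssubst a (fun i => ssubst (Phi i) Psi).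
Proof.
move=> h1 h2; apply/funext => m; set d := mdeg m.
rewrite [LHS](@scompE _ _ _ d) // [RHS](@scompE _ _ _ d) //; last exact: scomp_order1.
transitivity ((trunc d a \mPo trunc_tuple d Phi) \mPo trunc_tuple d Psi)@_m.
  apply: (@mpoly_eq_upto_compl _ _ _ d) (leqnn _) => [i|];
    first by rewrite tnth_trunc trunc_coef0.
  exact: trunc_scomp.
rewrite comp_mpolyA; apply: (@mpoly_eq_upto_compr _ _ _ d) (leqnn _) => i.
by rewrite tnth_mktuple !tnth_trunc => k hk; rewrite -trunc_scomp.
Qed.

Lemma svar_order1 N : order1 (svar R N).
Proof. by move=> i; rewrite svar_coef0. Qed.

Lemma scomp_id N (a : series R N) : ssubst a (svar R N) = a.
Proof.
apply/funext => m; rewrite (@scompE _ _ _ (mdeg m).+1) //; last exact: svar_order1.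
rewrite (_ : trunc_tuple _ _ = [tuple 'X_i | i < N]).
  by rewrite comp_mpoly_id mcoeff_trunc leqnSn.
by apply: eq_from_tnth => i; rewrite tnth_trunc tnth_mktuple trunc_svar.
Qed.

End CompComp.

(** * Weighted norms *)

Section Normc.
Variable R : realType.
Implicit Types x y : R[i].

Lemma normc_ge0 x : 0 <= normc x.
Proof. by case: x => a b; apply: sqrtr_ge0. Qed.
Lemma normc_le_sum (I : Type) (r : seq I) (P : pred I) (F : I -> R[i]) :
  normc (\sum_(i <- r | P i) F i) <= \sum_(i <- r | P i) normc (F i).
Proof.
elim/big_rec2: _ => [|i u v _ h]; first by rewrite Normc.normc0.
by apply: le_trans (complex.le_normcD _ _) _; rewrite lerD2l.
Qed.
Lemma normcMn x k : normc (x *+ k) = normc x *+ k.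
Proof. exact: complex.normcMn. Qed.
Lemma normcN x : normc (- x) = normc x.
Proof. exact: complex.normcN. Qed.
Lemma normc_nat k : normc (k%:R : R[i]) = k%:R.
Proof. by rewrite normcMn Normc.normc1. Qed.
End Normc.

Section WeightedNorm.
Variables (R : realType) (N : nat).
Local Notation C := R[i].
Local Notation S := (series R N).
Implicit Types (a b : S) (m : 'X_{1..N}) (w : 'X_{1..N} -> R).

(** A bound on the weighted l1 norm, phrased with finite partial sums so that no infinite sum has to
    be manipulated. *)
Definition norm_le w a (A : R) := forall s : seq 'X_{1..N}, uniq s ->
  \sum_(m <- s) normc (a m) * w m <= A.

Lemma norm_le_ge0 w a A : norm_le w a A -> 0 <= A.
Proof. by move=> /(_ [::] isT); rewrite big_nil. Qed.

Lemma norm_le_mono w a A A' : A <= A' -> norm_le w a A -> norm_le w a A'.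
Proof. by move=> h ha s us; apply: le_trans (ha s us) h. Qed.

(** Common source of the bounds for derivatives, shifts, restriction to w = 0 and the inverse Euler
    operator, each of which reindexes coefficients injectively and rescales them. *)
Lemma norm_le_inj w w' (f : 'X_{1..N} -> 'X_{1..N}) a b A : injective f ->
  (forall m, normc (b m) * w' m <= normc (a (f m)) * w (f m)) ->
  norm_le w a A -> norm_le w' b A.
Proof.
move=> fi h ha s us; apply: le_trans (ler_sum _ (fun m _ => h m)) _.
rewrite -(big_map f predT (fun m => normc (a m) * w m)).
by apply: ha; rewrite map_inj_uniq.
Qed.

Lemma norm_le_weight w w' a A : (forall m, w' m <= w m) ->
  norm_le w a A -> norm_le w' a A.
Proof.
by move=> h; apply: (@norm_le_inj w w' id) => // m; apply: ler_wpM2l (h m);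
  apply: normc_ge0.
Qed.

Lemma norm_leD w a b A B : (forall m, 0 <= w m) ->
  norm_le w a A -> norm_le w b B -> norm_le w (a + b) (A + B).
Proof.
move=> w0 ha hb s us; apply: le_trans (lerD (ha s us) (hb s us)).
rewrite -big_split; apply: ler_sum => m _ /=; rewrite -mulrDl.
by apply: ler_wpM2r => //; rewrite saddE; apply: complex.le_normcD.
Qed.

Lemma norm_leN w a A : norm_le w a A -> norm_le w (- a) A.
Proof. by move=> h s us; under eq_bigr do rewrite soppE normcN; apply: h. Qed.

Lemma norm_leB w a b A B : (forall m, 0 <= w m) ->
  norm_le w a A -> norm_le w b B -> norm_le w (a - b) (A + B).
Proof. by move=> w0 ha hb; apply: norm_leD => //; apply: norm_leN. Qed.

Lemma norm_le_supp1 w a m0 : (forall m, m != m0 -> a m = 0) -> 0 <= w m0 ->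
  norm_le w a (normc (a m0) * w m0).
Proof.
move=> h w0 s us.
have nn : 0 <= normc (a m0) * w m0 by rewrite mulr_ge0 ?normc_ge0.
case: (boolP (m0 \in s)) => hm0.
  by rewrite (bigD1_seq m0) //= big1 ?addr0 // => m hm; rewrite h // Normc.normc0 mul0r.
rewrite big1_seq // => m /= hm; rewrite h ?Normc.normc0 ?mul0r //.
by apply: contraNneq hm0 => <-.
Qed.

Lemma norm_le_scst w c : 0 <= w 0%MM -> norm_le w (scst c : S) (normc c * w 0%MM).
Proof.
move=> w0; have := @norm_le_supp1 w (scst c : S) 0%MM.
rewrite scst_coef eqxx; apply => // m hm; by rewrite scst_coef (negPf hm).
Qed.

Lemma norm_le0 w : norm_le w (0 : S) 0.
Proof. by move=> s us; rewrite big1 // => m _; rewrite szeroE Normc.normc0 mul0r. Qed.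

Lemma norm_le1 w : w 0%MM = 1 -> norm_le w (1 : S) 1.
Proof. by move=> w1; have := @norm_le_scst w 1; rewrite w1 mulr1 Normc.normc1;
  apply. Qed.

Lemma norm_le_svar w i : 0 <= w U_(i)%MM -> norm_le w (svar R N i) (w U_(i)%MM).
Proof.
move=> w0; have := @norm_le_supp1 w (svar R N i) U_(i)%MM.
rewrite svar_coef eqxx Normc.normc1 mul1r; apply => // m hm.
by rewrite svar_coef (negPf hm).
Qed.

Lemma norm_le_sum w (I : Type) (r : seq I) (F : I -> S) (A : I -> R) :
  (forall m, 0 <= w m) -> (forall i, norm_le w (F i) (A i)) ->
  norm_le w (\sum_(i <- r) F i) (\sum_(i <- r) A i).
Proof.
move=> w0 h; elim/big_rec2: _ => [|i u v _ ih]; first exact: norm_le0.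
exact: norm_leD.
Qed.

Lemma norm_le_bounded d w a A : norm_le w a A ->
  \sum_(k : 'X_{1..N < d}) normc (a k) * w k <= A.
Proof.
move=> h; rewrite -(big_map (@bmnm N d) predT (fun m => normc (a m) * w m)).
apply: h; rewrite map_inj_uniq ?index_enum_uniq //; exact: val_inj.
Qed.

Lemma seq_mdeg_bound (s : seq 'X_{1..N}) : exists d, forall m, m \in s ->
  (mdeg m < d)%N.
Proof.
elim: s => [|m s [d hd]]; first by exists 0%N.
exists (maxn (mdeg m).+1 d) => k; rewrite inE leq_max => /orP [/eqP->|/hd ->].
  by rewrite ltnSn.
by rewrite orbT.
Qed.

(** Three different weights, compared only on the support of [a]: the gain in the iteration exists
    only because its first factor has no term of degree 0 in z. *)
Lemma norm_leM w0 w1 w2 a b A B :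
  (forall m, 0 <= w0 m) -> (forall m, 0 <= w1 m) -> (forall m, 0 <= w2 m) ->
  (forall m1 m2, a m1 != 0 -> w2 (m1 + m2)%MM <= w0 m1 * w1 m2) ->
  norm_le w0 a A -> norm_le w1 b B -> norm_le w2 (a * b) (A * B).
Proof.
move=> h0 h1 h2' h2 ha hb s us; have [d hd] := seq_mdeg_bound s.
pose X (k : 'X_{1..N < d} * 'X_{1..N < d}) :=
  (normc (a k.1) * w0 k.1) * (normc (b k.2) * w1 k.2).
have X0 k : 0 <= X k by rewrite !mulr_ge0 ?normc_ge0.
apply: (@le_trans _ _ (\sum_(m <- s) \sum_(k : 'X_{1..N < d} * 'X_{1..N < d} | m ==
  (k.1 + k.2)%MM) X k)).
  rewrite [X in X <= _]big_seq [X in _ <= X]big_seq; apply: ler_sum => m hm.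
  rewrite (smul_sum _ _ (hd _ hm)).
  apply: le_trans (ler_wpM2r (h2' _) (normc_le_sum _ _ _)) _.
  rewrite mulr_suml; apply: ler_sum => -[k1 k2] /= /eqP ->; rewrite /X /= Normc.normcM.
  have [->|ak] := eqVneq (a k1) 0; first by rewrite Normc.normc0 !mul0r.
  apply: le_trans (ler_wpM2l _ (h2 _ _ ak)) _; first by rewrite mulr_ge0 ?normc_ge0.
  by rewrite mulrACA.
rewrite (exchange_big_dep predT) //=.
apply: (@le_trans _ _ (\sum_k X k)).
  apply: ler_sum => k _; case: (boolP ((k.1 + k.2)%MM \in s)) => hk.
    rewrite big_mkcond (bigD1_seq (k.1 + k.2)%MM) //= eqxx big1 ?addr0 // => m hm.
    by rewrite (negPf hm).
  rewrite big_mkcond big1_seq // => m /= hm; case: eqP => // e.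
  by rewrite -e hm in hk.
rewrite -(pair_bigA _ (fun k1 k2 => X (k1, k2))) /=.
under eq_bigr do rewrite /X /= -mulr_sumr.
rewrite -mulr_suml; apply: ler_pM; rewrite ?sumr_ge0 //.
- by move=> k _; rewrite mulr_ge0 ?normc_ge0.
- by move=> k _; rewrite mulr_ge0 ?normc_ge0.
- exact: norm_le_bounded.
- exact: norm_le_bounded.
Qed.

(* The balls of these norms are closed for coefficientwise convergence; this is how
   formal solutions are shown to converge. *)
Lemma norm_le_approx w a A :
  (forall s : seq 'X_{1..N}, exists2 a' : S, norm_le w a' A & forall m, m \in s ->
    a m = a' m) ->
  norm_le w a A.
Proof.
move=> h s us; have [a' ha' e] := h s; apply: le_trans (ha' s us).
by rewrite [X in X <= _]big_seq [X in _ <= X]big_seq; apply: ler_sum => m hm; rewrite e.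
Qed.

Definition multiplicative_weight w :=
  [/\ w 0%MM = 1, forall m, 0 <= w m & forall m1 m2, w (m1 + m2)%MM <= w m1 * w m2].

Lemma norm_leMm w a b A B : multiplicative_weight w ->
  norm_le w a A -> norm_le w b B -> norm_le w (a * b) (A * B).
Proof. by move=> [_ w0 wM]; apply: norm_leM. Qed.

Lemma norm_leX w a A k : multiplicative_weight w ->
  norm_le w a A -> norm_le w (a ^+ k) (A ^+ k).
Proof.
move=> hw ha; elim: k => [|k ih]; first by case: hw => w1 _ _; rewrite !expr0;
  apply: norm_le1.
by rewrite !exprS; apply: norm_leMm.
Qed.

Lemma norm_le_prod w (I : Type) (r : seq I) (F : I -> S) (A : I -> R) :
  multiplicative_weight w -> (forall i, norm_le w (F i) (A i)) ->
  norm_le w (\prod_(i <- r) F i) (\prod_(i <- r) A i).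
Proof.
move=> hw h; elim: r => [|i r ih]; first by case: hw => w1 _ _; rewrite !big_nil;
  apply: norm_le1.
by rewrite !big_cons; apply: norm_leMm.
Qed.

Definition rweight (r : R) m := r ^+ mdeg m.

Lemma rweight_multiplicative r : 0 <= r -> multiplicative_weight (rweight r).
Proof.
move=> r0; split=> [|m|m1 m2]; rewrite /rweight; first by rewrite mdeg0.
  exact: exprn_ge0.
by rewrite mdegD exprD.
Qed.

End WeightedNorm.

Section CompNorm.
Variables (R : realType) (N K : nat).
Implicit Types (a : series R N) (Phi : 'I_N -> series R K).

Lemma trunc_prod d (I : Type) (r : seq I) (F : I -> series R K) :
  mpoly_eq_upto d (trunc d (\prod_(i <- r) F i)) (\prod_(i <- r) trunc d (F i)).
Proof.
elim: r => [|i r ih].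
  by rewrite !big_nil -scst1 trunc_scst mpolyC1.
rewrite !big_cons; apply: mpoly_eq_upto_trans (@trunc_smul _ _ _ _ _) _.
exact: mpoly_eq_uptoM.
Qed.

Lemma trunc_exp d (F : series R K) k : mpoly_eq_upto d (trunc d (F ^+ k)) (trunc d F
  ^+ k).
Proof.
elim: k => [|k ih]; first by rewrite !expr0 -scst1 trunc_scst mpolyC1.
rewrite !exprS; apply: mpoly_eq_upto_trans (@trunc_smul _ _ _ _ _) _.
exact: mpoly_eq_uptoM.
Qed.

Lemma scomp_sumE d a Phi m : order1 Phi -> (mdeg m < d)%N ->
  ssubst a Phi m =
  (\sum_(k : 'X_{1..N < d}) scst (a k) * \prod_(i < N) Phi i ^+ k i) m.
Proof.
case: d => // d h0; rewrite ltnS => hm.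
rewrite (scompE _ h0 hm) [trunc d a]/trunc (raddf_sum (comp_mpoly _)) (raddf_sum
  (mcoeff m)) ssum_coef.
apply: eq_bigr => k _ /=; rewrite scst_mul_coef comp_mpolyZ mcoeffZ comp_mpolyX;
  congr (_ * _).
have -> : (\prod_(i < N) Phi i ^+ k i) m = (trunc d (\prod_(i < N) Phi i ^+ k i))@_m.
  by rewrite mcoeff_trunc hm.
rewrite trunc_prod //; symmetry; apply: (@mpoly_eq_upto_prod _ _ d) (hm) => i.
by rewrite tnth_trunc; apply: trunc_exp.
Qed.

(** Each monomial of degree d becomes a product of norm at most [rho ^+ d], so the norm after
    substitution is dominated by the norm of [a] at radius [rho]. *)
Lemma norm_le_scomp w a Phi (rho A : R) : multiplicative_weight w -> order1 Phi ->
  (forall i, norm_le w (Phi i) rho) -> norm_le (rweight rho) a A ->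
  norm_le w (ssubst a Phi) A.
Proof.
move=> hw h0 hPhi ha; apply: norm_le_approx => s.
have [d hd] := seq_mdeg_bound s.
exists (\sum_(k : 'X_{1..N < d}) scst (a k) * \prod_(i < N) Phi i ^+ k i); last first.
  by move=> m hm; rewrite (scomp_sumE _ h0 (hd _ hm)).
apply: norm_le_mono (norm_le_bounded d ha) _.
have [w1 w0 _] := hw; apply: norm_le_sum => // k; apply: norm_leMm => //.
  by have := @norm_le_scst _ _ w (a k); rewrite w1 mulr1; apply.
rewrite /rweight mdegE expr_sum; apply: norm_le_prod => // i; exact: norm_leX.
Qed.

End CompNorm.

(** * Convergent series *)

Section Convergence.
Variables (R : realType).
Implicit Types (N : nat).

(** For nonnegative terms, summability is boundedness of the finite partial sums. *)
Lemma convergentP N (a : series R N) :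
  convergent a <-> exists2 r : R, 0 < r & exists A, norm_le (rweight r) a A.
Proof.
split=> [[r r0 ha]|[r r0 [A ha]]]; exists r => //.
  exists (fine (\esum_(m in setT) abse (normc (a m) * r ^+ mdeg m)%:E)) => s us.
  rewrite -lee_fin fineK; last by rewrite -summableE.
  apply: esum_ge; exists [set` s]%classic; first by split=> //; apply: finite_seq.
  rewrite -(fsbig_seq _ _ us) -sumEFin; apply: lee_sum => m _ /=.
  by rewrite ger0_norm // mulr_ge0 ?normc_ge0 ?exprn_ge0 // ltW.
rewrite /summable; apply: (@le_lt_trans _ _ A%:E); last exact: ltry.
apply: ge_ereal_sup => _ [X [fX _] <-].
have [s us ->] : exists2 s : seq 'X_{1..N}, uniq s & X = [set` s]%classic.
  have [s ->] := (finite_seqP X).1 fX; exists (undup s); first exact: undup_uniq.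
  by apply/seteqP; split=> x /=; rewrite mem_undup.
rewrite -(fsbig_seq _ _ us) /= sumEFin lee_fin; apply: le_trans (ha s us).
apply: ler_sum => m _.
by rewrite ger0_norm // mulr_ge0 ?normc_ge0 ?exprn_ge0 // ltW.
Qed.

Lemma rweight_le N (r r' : R) (m : 'X_{1..N}) : 0 <= r' -> r' <= r ->
  rweight r' m <= rweight r m.
Proof. by move=> h0 h; apply: lerXn2r => //; rewrite nnegrE // (le_trans h0 h). Qed.

Lemma norm_le_radius N (a : series R N) (r r' : R) A : 0 <= r' -> r' <= r ->
  norm_le (rweight r) a A -> norm_le (rweight r') a A.
Proof. by move=> h0 h; apply: norm_le_weight => m; apply: rweight_le. Qed.

Lemma common_radius (I : finType) (P : I -> R -> Prop) :
  (forall i r r', 0 < r' -> r' <= r -> P i r -> P i r') ->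
  (forall i, exists2 r, 0 < r & P i r) -> exists2 r, 0 < r & forall i, P i r.
Proof.
move=> mono h.
suff [r r0 hr] : exists2 r, 0 < r & forall i, i \in enum I -> P i r.
  by exists r => // i; apply: hr; rewrite mem_enum.
elim: (enum I) => [|i s [r r0 ih]]; first by exists 1.
have [r' r'0 h'] := h i; exists (Num.min r r'); first by rewrite lt_min r0.
move=> j; rewrite inE => /orP[/eqP ->|/ih hj].
  by apply: mono h'; rewrite ?lt_min ?r0 // ge_min lexx orbT.
by apply: mono hj; rewrite ?lt_min ?r0 // ge_min lexx.
Qed.

Lemma convergent2 N (a b : series R N) : convergent a -> convergent b ->
  exists2 r : R, 0 < r &
    (exists A, norm_le (rweight r) a A) /\ (exists B, norm_le (rweight r) b B).
Proof.
move=> /convergentP [r r0 [A hA]] /convergentP [s s0 [B hB]].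
have h0 : 0 < Num.min r s by rewrite lt_min r0.
exists (Num.min r s) => //; split.
  by exists A; apply: norm_le_radius hA; rewrite ?ge_min ?lexx // ltW.
by exists B; apply: norm_le_radius hB; rewrite ?ge_min ?lexx ?orbT // ltW.
Qed.

Lemma rweight_ge0 N (r : R) : 0 < r -> forall m : 'X_{1..N}, 0 <= rweight r m.
Proof. by move=> h m; rewrite exprn_ge0 // ltW. Qed.

Lemma convergentD N (a b : series R N) : convergent a -> convergent b ->
  convergent (a + b).
Proof.
move=> ha hb; have [r r0 [[A hA] [B hB]]] := convergent2 ha hb.
apply/convergentP; exists r => //; exists (A + B).
by apply: norm_leD => //; apply: rweight_ge0.
Qed.

Lemma convergentM N (a b : series R N) : convergent a -> convergent b ->
  convergent (a * b).
Proof.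
move=> ha hb; have [r r0 [[A hA] [B hB]]] := convergent2 ha hb.
apply/convergentP; exists r => //; exists (A * B).
by apply: norm_leMm => //; apply: rweight_multiplicative; apply: ltW.
Qed.

Lemma convergentN N (a : series R N) : convergent a -> convergent (- a).
Proof.
by move=> /convergentP [r r0 [A h]]; apply/convergentP; exists r => //; exists A;
  apply: norm_leN.
Qed.

Lemma convergentB N (a b : series R N) : convergent a -> convergent b ->
  convergent (a - b).
Proof. by move=> ha hb; apply: convergentD => //; apply: convergentN. Qed.

Lemma convergent_scst N (c : R[i]) : convergent (scst c : series R N).
Proof.
apply/convergentP; exists 1 => //; exists (normc c * rweight 1 (0%MM : 'X_{1..N})).
by apply: norm_le_scst; rewrite /rweight exprn_ge0.
Qed.

Lemma convergent0 N : convergent (0 : series R N).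
Proof. by rewrite -scst0; apply: convergent_scst. Qed.

Lemma convergent1 N : convergent (1 : series R N).
Proof. by rewrite -scst1; apply: convergent_scst. Qed.

Lemma convergent_svar N i : convergent (svar R N i).
Proof.
apply/convergentP; exists 1 => //; exists (rweight 1 U_(i)%MM).
by apply: norm_le_svar; rewrite /rweight exprn_ge0.
Qed.

Lemma convergent_sum N (I : Type) (s : seq I) (F : I -> series R N) :
  (forall i, convergent (F i)) -> convergent (\sum_(i <- s) F i).
Proof.
move=> h; elim/big_rec: _ => [|i u _ ih]; first exact: convergent0.
exact: convergentD.
Qed.

Lemma convergent_sder N i (a : series R N) : convergent a -> convergent (spder i a).
Proof.
(* Halving the radius absorbs the factor [(m i).+1], which is at most [2 ^ mdeg m]; the shift of the
   index costs [r^-1]. *)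
move=> /convergentP [r r0 [A h]]; apply/convergentP; exists (r / 2); first by lra.
exists (r^-1 * A); have ri0 : 0 <= r^-1 by rewrite invr_ge0 ltW.
have hs : norm_le (fun m => r * rweight r m) (fun m => a (m + U_(i))%MM) A.
  apply: (@norm_le_inj _ _ _ _ (fun m => m + U_(i))%MM) h; first exact: addIm.
  by move=> m; rewrite /rweight mdegD mdeg1 addn1 exprS.
move=> s us; have := hs s us; rewrite -(ler_pM2l (_ : 0 < r^-1)) ?invr_gt0 //.
apply: le_trans; rewrite mulr_sumr; apply: ler_sum => m _.
rewrite [r^-1 * _]mulrCA mulKf ?gt_eqF // sder_coef normcMn -[_ *+ (m i).+1]mulr_natr
  -mulrA.
apply: ler_wpM2l; first exact: normc_ge0.
rewrite /rweight expr_div_n mulrCA; apply: ler_piMr; first by rewrite exprn_ge0 // ltW.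
rewrite ler_pdivrMr ?exprn_gt0 // mul1r -natrX ler_nat.
apply: leq_trans (ltn_expl (mdeg m) (ltnSn 1)).
by rewrite ltnS mdegE (bigD1 i) //= leq_addr.
Qed.

Definition sorder N (d : nat) (a : series R N) := forall m, (mdeg m < d)%N -> a m = 0.

Lemma norm_le_shrink N (a : series R N) (r t : R) A k : sorder k a -> 0 <= r ->
  0 <= t <= 1 ->
  norm_le (rweight r) a A -> norm_le (rweight (t * r)) a (t ^+ k * A).
Proof.
move=> ak r0 /andP[t0 t1] h s us.
apply: le_trans (ler_wpM2l (exprn_ge0 k t0) (h s us)).
rewrite mulr_sumr; apply: ler_sum => m _.
have [hm|hm] := ltnP (mdeg m) k; first by rewrite ak // Normc.normc0 !mul0r mulr0.
rewrite mulrCA; apply: ler_wpM2l; first exact: normc_ge0.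
rewrite /rweight exprMn; apply: ler_wpM2r; first exact: exprn_ge0.
by rewrite -(subnKC hm) exprD ler_piMr ?exprn_ge0 // exprn_ile1.
Qed.

Lemma sorder1 N (a : series R N) : a 0%MM = 0 -> sorder 1 a.
Proof. by move=> h m; rewrite ltnS leqn0 mdeg_eq0 => /eqP ->. Qed.

Lemma sorderM N d e (a b : series R N) : sorder d a -> sorder e b ->
  sorder (d + e) (a * b).
Proof.
move=> ha hb m hm; rewrite (smul_sum _ _ (ltnSn _)) big1 // => -[k1 k2] /= /eqP em.
have hd : (mdeg k1 + mdeg k2 < d + e)%N by rewrite -mdegD -em.
case: (ltnP (mdeg k1) d) => h; first by rewrite ha ?mul0r.
by rewrite hb ?mulr0 //; lia.
Qed.

Lemma sorderX N d (a : series R N) : a 0%MM = 0 -> sorder d (a ^+ d).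
Proof.
move=> ha; elim: d => [|d ih]; first by [].
by rewrite exprS -add1n; apply: sorderM => //; apply: sorder1.
Qed.

Lemma sorder_prod N (I : Type) (s : seq I) (k : I -> nat) (F : I -> series R N) :
  (forall i, sorder (k i) (F i)) -> sorder (\sum_(i <- s) k i)%N (\prod_(i <- s) F i).
Proof.
move=> h; elim: s => [|i s ih]; first by rewrite big_nil.
by rewrite !big_cons; apply: sorderM.
Qed.

Lemma sorder_sum N d (I : Type) (s : seq I) (F : I -> series R N) :
  (forall i, sorder d (F i)) -> sorder d (\sum_(i <- s) F i).
Proof. by move=> h m hm; rewrite ssum_coef big1 // => i _; apply: h. Qed.

Lemma sorder_le N d e (a : series R N) : (e <= d)%N -> sorder d a -> sorder e a.
Proof. by move=> hed h m hm; apply: h; apply: leq_trans hed. Qed.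

Lemma norm_le_small N (a : series R N) (e : R) : a 0%MM = 0 -> convergent a -> 0 < e ->
  exists2 r : R, 0 < r & norm_le (rweight r) a e.
Proof.
move=> a0 /convergentP [r r0 [A h]] e0.
have A0 := norm_le_ge0 h; have A1 : 0 < 1 +
  A / e by rewrite ltr_pwDl // divr_ge0 // ltW.
(* Shrinking by t = 1/(1 + A/e) multiplies the bound of a series of order 1 by t, and t A = e A/(e +
   A) is at most e. *)
exists ((1 + A / e)^-1 * r); first by rewrite mulr_gt0 // invr_gt0.
have t01 : 0 <= (1 + A / e)^-1 <= 1.
  by rewrite invr_ge0 ltW //= invf_le1 // lerDl divr_ge0 // ltW.
apply: norm_le_mono (norm_le_shrink (sorder1 a0) (ltW r0) t01 h); rewrite expr1.
rewrite mulrC ler_pdivrMr // mulrDr mulr1 mulrCA mulfV ?gt_eqF // mulr1.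
by rewrite lerDr ltW.
Qed.

Lemma convergent_scomp N K (a : series R N) (Phi : 'I_N -> series R K) :
  order1 Phi -> convergent a -> (forall i, convergent (Phi i)) ->
    convergent (ssubst a Phi).
Proof.
move=> h0 /convergentP [rho rho0 [A hA]] hPhi.
have [r r0 hr] : exists2 r : R, 0 < r & forall i, norm_le (rweight r) (Phi i) rho.
  apply: common_radius => [i r r' r'0 h|i]; first by apply: norm_le_radius => //;
    apply: ltW.
  exact: norm_le_small.
apply/convergentP; exists r => //; exists A; apply: norm_le_scomp hr hA => //.
by apply: rweight_multiplicative; apply: ltW.
Qed.

End Convergence.

(** * The analytic implicit function theorem *)

Section FixedPoint.
Variables (R : realType) (N : nat) (I : Type) (delta : 'X_{1..N} -> nat).
Local Notation state := (I -> series R N).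
Implicit Types (x y : state).

Definition agree k x y := forall i m, (delta m < k)%N -> x i m = y i m.

(** The iterates stabilise degree by degree, and the coefficient of the limit at [m] is that of
    iterate [(delta m).+1]; [inv] carries the norm bounds over to the limit. The grading [delta] is
    the total degree in the implicit function theorem and the degree in z in the equation for v. *)
Lemma fixed_point (T : state -> state) (inv : state -> Prop) x0 :
  inv x0 -> (forall x, inv x -> inv (T x)) ->
  (forall k x y, inv x -> inv y -> agree k x y -> agree k.+1 (T x) (T y)) ->
  (forall x, (forall k, exists2 y, inv y & agree k x y) -> inv x) ->
  exists2 x, inv x & T x = x.
Proof.
move=> h0 hT hc hlim; pose xs k := iter k T x0.
have hi k : inv (xs k) by elim: k => //= k; apply: hT.
have hS k : agree k (xs k) (xs k.+1).
  by elim: k => [|k ih] //=; apply: hc ih => //; apply: hi k.+1.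
have hle k l : (k <= l)%N -> agree k (xs k) (xs l).
  move=> hkl; rewrite -(subnKC hkl); elim: (l - k)%N => [|j ih]; first by rewrite addn0.
  move=> i m hm; rewrite ih // addnS; apply: hS; exact: leq_trans (leq_addr _ _).
pose x : state := fun i m => xs (delta m).+1 i m.
have hx k : agree k x (xs k) by move=> i m hm; rewrite /x (hle _ k).
have ix : inv x by apply: hlim => k; exists (xs k).
exists x => //; apply/funext => i; apply/funext => m.
rewrite (hc (delta m) x (xs (delta m))) //.
Qed.

End FixedPoint.

Lemma sub_sub_cancel (A : comPzRingType) (x a b : A) : x - a - (x - b) = b - a.
Proof. ring. Qed.

Section LastVariable.
Variables (R : realType) (n : nat).
Local Notation S := (series R n.+1).
Local Notation w := (@ord_max n).
Implicit Types (phi psi : S).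

Definition wmap phi : 'I_n.+1 -> S := fun i => if i == w then phi else svar R n.+1 i.

Lemma wmap_w phi : wmap phi w = phi. Proof. by rewrite /wmap eqxx. Qed.
Lemma wmap_z phi i : i != w -> wmap phi i = svar R n.+1 i.
Proof. by rewrite /wmap => /negPf ->. Qed.
Lemma wmap_order1 phi : phi 0%MM = 0 -> order1 (wmap phi).
Proof. by move=> h i; rewrite /wmap; case: ifP => // _; rewrite svar_coef0. Qed.
Lemma wmap_id : wmap (svar R n.+1 w) = svar R n.+1.
Proof. by apply/funext => i; rewrite /wmap; case: eqP => [->|]. Qed.
Lemma wmap_comp phi psi : phi 0%MM = 0 ->
  (fun i => ssubst (wmap psi i) (wmap phi)) = wmap (ssubst psi (wmap phi)).
Proof.
move=> h; apply/funext => i; rewrite {1 3}/wmap; case: ifP => // hi.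
by rewrite scomp_svar; [rewrite wmap_z // hi | apply: wmap_order1].
Qed.

(** On a monomial z^J w^j with j > 0, the difference phi^j - phi'^j is phi - phi' times a factor of
    order j - 1, and |J| + j - 1 is at least 1 except for the monomial w, which is excluded. For j =
    0 the two terms cancel. *)
Lemma scomp_wmap_sub (g : S) phi phi' k : phi 0%MM = 0 -> phi' 0%MM = 0 ->
  g U_(w)%MM = 0 -> sorder k (phi - phi') ->
  sorder k.+1 (ssubst g (wmap phi) - ssubst g (wmap phi')).
Proof.
move=> h0 h0' gw hk m hm.
rewrite ssubE !(@scomp_sumE _ _ _ (mdeg m).+1) //; try exact: wmap_order1.
rewrite -ssubE -sumrB ssum_coef big1 // => j _; rewrite -mulrBr scst_mul_coef.
have [->|hj] := eqVneq (bmnm j) U_(w)%MM; first by rewrite gw mul0r.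
have e (f : S) : \prod_(i < n.+1) wmap f i ^+ j i =
    f ^+ j w * \prod_(i < n.+1 | i != w) svar R n.+1 i ^+ j i.
  rewrite (bigD1 w isT) wmap_w; apply: congr1; apply: eq_bigr => i hi.
  by rewrite wmap_z.
rewrite !e -mulrBl subrXX; case: (posnP (j w)) => jw.
  by rewrite jw big_ord0 mulr0 mul0r szeroE mulr0.
have o1 : sorder (k + (j w).-1) ((phi - phi') * (\sum_(i < j w) phi ^+ ((j w).-1 - i)
  * phi' ^+ i)).
  apply: sorderM => //; apply: sorder_sum => i.
  apply: (@sorder_le _ _ ((j w).-1 - i + i)); first by lia.
  by apply: sorderM; apply: sorderX.
have o2 : sorder (\sum_(i < n.+1 | i != w) j i)%N (\prod_(i < n.+1 | i != w) svar R
  n.+1 i ^+ j i).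
  rewrite -!(big_filter _ (fun i => i != w)); apply: sorder_prod => i.
  by apply: sorderX; rewrite svar_coef0.
have jd : mdeg j = (j w + \sum_(i < n.+1 | i != w) j i)%N by rewrite mdegE (bigD1 w).
have j2 : (1 < mdeg j)%N.
  rewrite ltn_neqAle; apply/andP; split; last by rewrite jd; lia.
  apply: contra hj => /eqP /esym hd; have : mdeg j == 1%N by rewrite hd.
  move=> /mdeg1P [i /eqP ei]; move: jw; rewrite ei mnm1E.
  by case: eqP => // ->.
rewrite (sorderM o1 o2) ?mulr0 //; lia.
Qed.

Lemma norm_le_approx_mdeg (wt : 'X_{1..n.+1} -> R) (a : S) A :
  (forall k, exists2 b : S, norm_le wt b A & forall m, (mdeg m < k)%N -> a m = b m) ->
  norm_le wt a A.
Proof.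
move=> h; apply: norm_le_approx => s; have [d hd] := seq_mdeg_bound s.
by have [b hb e] := h d; exists b => // m hm; apply: e; apply: hd.
Qed.

(** The equation psi(z, phi) = w is rewritten as phi = c^-1 (w - g(z, phi)), where c is the
    w-derivative of psi at 0 and g = psi - c w, and solved by iteration. *)
Lemma wmap_right_inverse psi : convergent psi -> psi 0%MM = 0 -> psi U_(w)%MM != 0 ->
  exists phi, [/\ convergent phi, phi 0%MM = 0 & ssubst psi (wmap phi) = svar R n.+1 w].
Proof.
move=> cpsi psi0; set c := psi U_(w)%MM => c0.
(* The part of [g] linear in z is not quadratically small, but the substitution does not change it.
   It joins the constant term w - [l], and only [h], of order 2, depends on the unknown. *)
pose l : S := \sum_(i < n.+1 | i != w) scst (psi U_(i)%MM) * svar R n.+1 i.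
pose g := psi - scst c * svar R n.+1 w.
pose h := g - l.
have l_coef m : l m = \sum_(i < n.+1 | i != w) (psi U_(i)%MM) * (m == U_(i)%MM)%:R.
  by rewrite /l ssum_coef; apply: eq_bigr => i _; rewrite scst_mul_coef.
have lU i : l U_(i)%MM = if i == w then 0 else psi U_(i)%MM.
  rewrite l_coef; case: eqP => [->|/eqP hi].
    by rewrite big1 // => j hj; rewrite mnm1_eq eq_sym (negPf hj) mulr0.
  rewrite (bigD1 i) //= eqxx mulr1 big1 ?addr0 // => j /andP[_ hj].
  by rewrite mnm1_eq eq_sym (negPf hj) mulr0.
have gU i : g U_(i)%MM = if i == w then 0 else psi U_(i)%MM.
  rewrite /g ssubE scst_mul_coef svar_coef mnm1_eq; case: eqP => [->|_].
    by rewrite mulr1 subrr.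
  by rewrite mulr0 subr0.
have g0 : g 0%MM = 0 by rewrite /g ssubE scst_mul_coef svar_coef0 mulr0 subr0.
have h_order : sorder 2 h.
  move=> m; rewrite ltnS leq_eqVlt ltnS leqn0 mdeg_eq0 =>
    /orP[/mdeg1P[i /eqP ->]|/eqP ->].
    by rewrite /h ssubE gU lU subrr.
  rewrite /h ssubE g0 l_coef big1 ?subrr // => i _.
  by rewrite eq_sym mnm1_eq0 mulr0.
have cg : convergent g.
  by apply: convergentB => //; apply: convergentM;
    [apply: convergent_scst|apply: convergent_svar].
have cl : convergent l.
  rewrite /l -big_filter; apply: convergent_sum => i.
  by apply: convergentM; [apply: convergent_scst|apply: convergent_svar].
have ch : convergent h by apply: convergentB.
have gE : g = l + h by rewrite /h addrC subrK.
have scomp_l phi : phi 0%MM = 0 -> ssubst l (wmap phi) = l.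
  move=> p0; rewrite scomp_sum; apply: eq_bigr => i hi.
  by rewrite scompM ?scomp_scst ?scomp_svar ?wmap_z //; apply: wmap_order1.
have cw0 : (svar R n.+1 w - l) 0%MM = 0.
  rewrite ssubE svar_coef0 l_coef big1 ?subrr // => i _.
  by rewrite eq_sym mnm1_eq0 mulr0.
have ccw : convergent (svar R n.+1 w - l) by apply: convergentB => //;
  apply: convergent_svar.
pose k := normc c^-1; have k0 : 0 < k.
  rewrite lt_neqAle normc_ge0 andbT eq_sym; apply/eqP => /Normc.eq0_normc /eqP.
  by rewrite invr_eq0 (negPf c0).
have [rho0 rho0_gt0 [A hA]] := (convergentP h).1 ch.
have A0 := norm_le_ge0 hA.
(* On the radius [rho] = [t] [rho0], the series [h] has norm at most t^2 A, and k t^2 A is at most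
   rho/2. The other half of the ball is left to w - [l], made smaller than rho/(2k) by the choice of
   [r]. *)
pose t := Num.min 1 (rho0 / (2 * (k * A + 1))).
have kA1 : 0 < k * A + 1 by rewrite ltr_pwDr // mulr_ge0 // ltW.
have t0 : 0 < t by rewrite /t lt_min ltr01 divr_gt0 // mulr_gt0.
have t1 : t <= 1 by rewrite /t ge_min lexx.
have t2 : t * (k * A + 1) <= rho0 / 2.
  have : t <= rho0 / (2 * (k * A + 1)) by rewrite ge_min lexx orbT.
  by rewrite invfM mulrA ler_pdivlMr.
pose rho := t * rho0; have rho_gt0 : 0 < rho by rewrite mulr_gt0.
have h_rho : norm_le (rweight rho) h (t ^+ 2 * A).
  by apply: norm_le_shrink => //; rewrite ltW //= ltW.
have [r1 r1_gt0 hr1] : exists2 r : R,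
  0 < r & norm_le (rweight r) (svar R n.+1 w - l) (rho / (2 * k)).
  by apply: norm_le_small => //; rewrite divr_gt0 // mulr_gt0.
pose r := Num.min r1 rho; have r_gt0 : 0 < r by rewrite /r lt_min r1_gt0.
have r_rho : r <= rho by rewrite /r ge_min lexx orbT.
have hr : norm_le (rweight r) (svar R n.+1 w - l) (rho / (2 * k)).
  by apply: norm_le_radius (ltW r_gt0) _ hr1; rewrite /r ge_min lexx.
have mw := @rweight_multiplicative _ n.+1 _ (ltW r_gt0).
pose T (phi : unit -> S) : unit -> S := fun _ =>
  scst c^-1 * (svar R n.+1 w - ssubst g (wmap (phi tt))).
pose inv (phi : unit -> S) := phi tt 0%MM = 0 /\ norm_le (rweight r) (phi tt) rho.
have TE (u : unit -> S) : inv u ->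
  T u tt = scst c^-1 * (svar R n.+1 w - l - ssubst h (wmap (u tt))).
  by move=> [p0 _]; rewrite /T gE scompD scomp_l // opprD addrA.
have [|phi iphi|j phi phi' iphi iphi' hag|phi happ|phi [phi0 nphi] fphi] :=
  @fixed_point R n.+1 unit (@mdeg n.+1) T inv (fun _ => 0).
- by split=> //; apply: norm_le_mono (ltW rho_gt0) (norm_le0 _).
- split; first by rewrite /T smul_coef0 ssubE svar_coef0 scomp_coef0 ?g0 ?subrr
  ?mulr0 //; apply: wmap_order1; case: iphi.
  rewrite TE //; have [p0 np] := iphi.
  have hk : norm_le (rweight r) (scst c^-1 : S) k.
    by have := @norm_le_scst _ n.+1 (rweight r) c^-1; case: mw => -> _ _;
      rewrite mulr1; apply.
  have hcomp : norm_le (rweight r) (ssubst h (wmap (phi tt))) (t ^+ 2 * A).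
    apply: norm_le_scomp h_rho => //; first exact: wmap_order1.
    move=> i; rewrite /wmap; case: ifP => _ //.
    apply: norm_le_mono (norm_le_svar _); last by case: mw.
    by rewrite /rweight mdeg1 expr1.
  apply: norm_le_mono (norm_leMm mw hk (norm_leB _ hr hcomp)); last by case: mw.
  rewrite mulrDr (_ : k * (rho / (2 * k)) = rho / 2); last by field; rewrite gt_eqF.
  have -> : k * (t ^+ 2 * A) = t * (t * (k * A)) by ring.
  have : t * (t * (k * A)) <= t * (rho0 / 2).
    apply: ler_wpM2l; first exact: ltW.
    by apply: le_trans t2; rewrite mulrDr mulr1 lerDl ltW.
  by rewrite /rho; lra.
- move=> [] m hm; rewrite /T; apply/eqP; rewrite -subr_eq0 -ssubE -mulrBr scst_mul_coef.
  rewrite sub_sub_cancel.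
  rewrite (@scomp_wmap_sub _ _ _ j) ?mulr0 //; try by case: iphi iphi' => ? _ [].
    by rewrite gU eqxx.
  by move=> m' hm'; rewrite ssubE hag // subrr.
- split; first by have [y [y0 _] ->] := happ 1%N; rewrite ?mdeg0.
  apply: norm_le_approx_mdeg => j; have [y [_ ny] hy] := happ j.
  by exists (y tt) => // m hm; apply: hy.
exists (phi tt); split=> //.
  by apply/convergentP; exists r => //; exists rho.
have -> : psi = g + scst c * svar R n.+1 w by rewrite subrK.
have o1 := wmap_order1 phi0.
rewrite scompD scompM // scomp_scst scomp_svar // wmap_w.
have := congr1 (fun f => f tt) fphi; rewrite /T => /(congr1 (fun a => scst c * a)).
rewrite mulrA -scstM mulfV // scst1 mul1r => <-.
by rewrite addrC subrK.
Qed.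

End LastVariable.

(** * Forms and changes of coordinates *)

Section Interface.
Variables (R : realType) (N : nat).
Local Notation S := (series R N).
Local Notation map := ('I_N -> S).
Implicit Types (theta : oneform R N) (Phi Psi : map).

Definition scale_form (h : S) theta : oneform R N := fun i => (h : S) * theta i.

Lemma pullbackE Phi theta j :
  pullback Phi theta j = \sum_i ssubst (theta i) Phi * spder j (Phi i).
Proof. by rewrite /pullback ssum_def smul_def scomp_def sder_def. Qed.

Definition integrand theta i j k : S :=
  theta i * (spder j (theta k) - spder k (theta j)) +
  (theta j * (spder k (theta i) - spder i (theta k)) +
   theta k * (spder i (theta j) - spder j (theta i))).

Lemma integrableP theta : integrable_form theta <-> forall i j k,
  integrand theta i j k = 0.
Proof.
rewrite /integrable_form /wedge12 /dform smul_def sder_def.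
split=> h i j k; first by apply/funext => m; apply: h.
by move=> m; have := congr1 (fun a : S => a m) (h i j k).
Qed.

Lemma wedge11E (a b : series R N) i j : wedge11 (dfun a) (dfun b) i j = spder i a *
  spder j b - spder j a * spder i b.
Proof. by rewrite /wedge11 /dfun smul_def sder_def. Qed.

Lemma dformE theta j k : dform theta j k = spder j (theta k) - spder k (theta j).
Proof. by rewrite /dform sder_def. Qed.

End Interface.

Section Forms.
Variables (R : realType) (N : nat).
Local Notation S := (series R N).
Local Notation map := ('I_N -> S).
Implicit Types (theta : oneform R N) (Phi Psi : map).

Lemma pullback_comp Phi Psi theta : order1 Phi -> order1 Psi ->
  pullback Psi (pullback Phi theta) = pullback (fun i => ssubst (Phi i) Psi) theta.
Proof.
move=> h1 h2; apply/funext => j; rewrite !pullbackE.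
under [LHS]eq_bigr => k _.
  rewrite pullbackE scomp_sum mulr_suml.
  under eq_bigr do rewrite scompM // scompA // -mulrA.
  over.
rewrite exchange_big; apply: eq_bigr => i _ /=.
by rewrite -mulr_sumr sder_scomp.
Qed.

Lemma pullback_scale Phi h theta : order1 Phi ->
  pullback Phi (scale_form h theta) = scale_form (ssubst h Phi) (pullback Phi theta).
Proof.
move=> h1; apply/funext => j.
rewrite pullbackE.
rewrite /scale_form.
rewrite [pullback Phi theta j]pullbackE.
rewrite mulr_sumr.
apply: eq_bigr => i _.
rewrite scompM //.
by rewrite mulrA.
Qed.

Lemma pullback_id theta : pullback (svar R N) theta = theta.
Proof.
apply/funext => j; rewrite pullbackE (bigD1 j) //= sder_svar eqxx mulr1 scomp_id.
by rewrite big1 ?addr0 // => i hi; rewrite sder_svar eq_sym (negPf hi) mulr0.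
Qed.

Lemma convergent_pullback Phi theta : germ_map Phi ->
  (forall i, convergent (theta i)) ->
  forall i, convergent (pullback Phi theta i).
Proof.
move=> hP ht j; rewrite pullbackE; apply: convergent_sum => i; apply: convergentM.
  by apply: convergent_scomp => // k; case: (hP k).
by apply: convergent_sder; case: (hP i).
Qed.

Lemma integrable_scale h theta : integrable_form theta ->
  integrable_form (scale_form h theta).
Proof.
move=> /integrableP hi; apply/integrableP => i j k.
rewrite /integrand /scale_form !sderM.
have := hi i j k; rewrite /integrand => /(congr1 (fun a : S => h * h * a)).
by rewrite mulr0 => <-; ring.
Qed.

(** Cyclic relabelling, used to align the three terms of the integrability condition of a
    pullback. *)
Lemma sum3_rot (A : nmodType) (I : finType) (F : I -> I -> I -> A) :
  \sum_a \sum_b \sum_c F a b c = \sum_a \sum_b \sum_c F b c a.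
Proof. by rewrite [RHS]exchange_big; apply: eq_bigr => b _ /=;
  rewrite [RHS]exchange_big. Qed.

Lemma sum_mul3 (A : comPzRingType) (I : finType) (X : I -> A) (Y : I -> I -> A) :
  (\sum_a X a) * (\sum_b \sum_c Y b c) = \sum_a \sum_b \sum_c X a * Y b c.
Proof.
rewrite mulr_suml; apply: eq_bigr => a _; rewrite mulr_sumr; apply: eq_bigr => b _.
by rewrite mulr_sumr.
Qed.

(** The exterior derivative commutes with pullback: the second derivatives of [Phi] are symmetric in
    [j] and [k] and cancel. *)
Lemma sder_pullback Phi theta j k : order1 Phi ->
  spder j (pullback Phi theta k) - spder k (pullback Phi theta j) =
  \sum_b \sum_c ssubst (dform theta b c) Phi * (spder j (Phi b) * spder k (Phi c)).
Proof.
move=> h1.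
have e (j' k' : 'I_N) : spder j' (pullback Phi theta k') =
  \sum_b \sum_c ssubst (spder b (theta c)) Phi * (spder j' (Phi b) * spder k' (Phi c)) +
  \sum_c ssubst (theta c) Phi * spder j' (spder k' (Phi c)).
  rewrite pullbackE sder_sum [X in X + _]exchange_big -big_split;
    apply: eq_bigr => c _ /=.
  rewrite sderM sder_scomp // mulr_suml; congr (_ + _); apply: eq_bigr => b _.
  by rewrite mulrA.
rewrite !e [X in _ - (_ + X)](eq_bigr (fun c =>
  ssubst (theta c) Phi * spder j (spder k (Phi c)))).
  2: by move=> c _; rewrite sder_comm.
rewrite opprD addrACA subrr addr0 [X in _ - X]exchange_big -sumrB;
  apply: eq_bigr => b _ /=.
rewrite -sumrB; apply: eq_bigr => c _.
rewrite dformE scompB; ring.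
Qed.

(** After relabelling, the product of the derivatives of Phi_a, Phi_b, Phi_c along i, j, k
    multiplies exactly the (a, b, c) coefficient of the integrability condition of [theta], composed
    with [Phi]. *)
Lemma integrable_pullback Phi theta : order1 Phi ->
  integrable_form theta -> integrable_form (pullback Phi theta).
Proof.
move=> h1 /integrableP hi; apply/integrableP => i j k.
rewrite /integrand !sder_pullback // !pullbackE !sum_mul3.
rewrite [X in _ + (X + _)]sum3_rot [X in _ + (_ + X)]sum3_rot [X in _ + (_ +
  X)]sum3_rot.
rewrite -!big_split big1 // => a _; rewrite /= -!big_split big1 // => b _.
rewrite /= -!big_split big1 // => c _ /=.
have := congr1 (fun s : S => ssubst s Phi * (spder i (Phi a) * spder j (Phi b) *
  spder k (Phi c))) (hi a b c).
rewrite /integrand scomp0 mul0r => <-.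
by rewrite !dformE !scompD !scompM // !(scompD, scompN); ring.
Qed.

Lemma germ_map_order1 Phi : germ_map Phi -> order1 Phi.
Proof. by move=> h i; case: (h i). Qed.

Lemma germ_map_comp Phi Psi : germ_map Phi -> germ_map Psi ->
  germ_map (fun i => ssubst (Phi i) Psi).
Proof.
move=> h1 h2 i; have o2 := germ_map_order1 h2; have [c0 z0] := h1 i; split.
  by apply: convergent_scomp => // j; case: (h2 j).
by rewrite scomp_coef0.
Qed.

Lemma germ_biholomorphismP Phi : germ_biholomorphism Phi <-> germ_map Phi /\
  exists2 Psi, germ_map Psi &
   (fun i => ssubst (Phi i) Psi) = svar R N /\ (fun i => ssubst (Psi i) Phi) = svar R N.
Proof.
rewrite /germ_biholomorphism scomp_def.
split=> -[h [Psi hP [e1 e2]]]; split=> //; exists Psi => //; split.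
- by apply/funext => i; apply/funext => m; apply: e1.
- by apply/funext => i; apply/funext => m; apply: e2.
- by move=> i m; have := congr1 (fun F : map => F i m) e1.
- by move=> i m; have := congr1 (fun F : map => F i m) e2.
Qed.

Lemma germ_biholomorphism_id : germ_biholomorphism (svar R N).
Proof.
have hid : germ_map (svar R N).
  by move=> i; split; [apply: convergent_svar | rewrite svar_coef0].
apply/germ_biholomorphismP; split=> //; exists (svar R N) => //.
by split; apply/funext => i; rewrite scomp_id.
Qed.

Lemma germ_biholomorphism_comp Phi Psi :
  germ_biholomorphism Phi -> germ_biholomorphism Psi ->
  germ_biholomorphism (fun i => ssubst (Phi i) Psi).
Proof.
move=> /germ_biholomorphismP [h1 [F hF [f1 f2]]] /germ_biholomorphismP [h2 [G hG [g1
  g2]]].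
have [o1 o2 oF oG] := And4 (germ_map_order1 h1) (germ_map_order1 h2)
  (germ_map_order1 hF) (germ_map_order1 hG).
apply/germ_biholomorphismP; split; first exact: germ_map_comp.
exists (fun i => ssubst (G i) F); first exact: germ_map_comp.
have oGF := scomp_order1 oG oF; have oPP := scomp_order1 o1 o2.
split; apply/funext => i.
  rewrite scompA // (_ : (fun j => ssubst (Psi j) _) = F).
    by have := congr1 (fun H : map => H i) f1.
  apply/funext => j; rewrite -scompA //.
  have := congr1 (fun H : map => H j) g1 => /= ->.
  by rewrite scomp_svar.
rewrite scompA // (_ : (fun j => ssubst (F j) _) = Psi).
  by have := congr1 (fun H : map => H i) g2.
apply/funext => j; rewrite -scompA //.
have := congr1 (fun H : map => H j) f2 => /= ->.
by rewrite scomp_svar.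
Qed.

End Forms.

(** * Reducibility to the normal form, and changes of the last coordinate alone *)

Section Normalizable.
Variables (R : realType) (n : nat).
Local Notation N := n.+1.
Local Notation S := (series R N).
Local Notation w := (@ord_max n).
Implicit Types (theta : oneform R N).

(** Stronger than defining the same foliation as a normal form: the multiplier [a] is a holomorphic
    unit. In this form the property passes easily through coordinate changes and multiplication by
    units. *)
Definition normalizable theta := exists Phi, germ_biholomorphism Phi /\
  exists (f0 f1 : series R n) (a : S),
    [/\ convergent f0, convergent f1, convergent a, a 0%MM != 0 &
        (forall i j, wedge11 (dfun f0) (dfun f1) i j =1 szero R n) /\
        scale_form a (pullback Phi theta) = normal_form f0 f1].

Lemma normalizable_pullback Phi theta : germ_biholomorphism Phi ->
  normalizable (pullback Phi theta) -> normalizable theta.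
Proof.
move=> hP [Psi [hPsi [f0 [f1 [a [h0 h1 ha a0 [hw he]]]]]]].
exists (fun i => ssubst (Phi i) Psi); split; first exact: germ_biholomorphism_comp.
exists f0, f1, a; split; [exact: h0|exact: h1|exact: ha|exact: a0|split;
  first exact: hw].
have o1 : order1 Phi by apply: germ_map_order1; case: hP.
have o2 : order1 Psi by apply: germ_map_order1; case: hPsi.
by rewrite -(pullback_comp _ o1 o2).
Qed.

Lemma normalizable_scale h theta : convergent h -> h 0%MM != 0 ->
  normalizable (scale_form h theta) -> normalizable theta.
Proof.
move=> ch h0 [Phi [hPhi [f0 [f1 [a [c0 c1 ca a0 [hw he]]]]]]].
have o1 : order1 Phi by apply: germ_map_order1; case: hPhi.
exists Phi; split; first exact: hPhi.
exists f0, f1, (a * ssubst h Phi); split; [exact: c0|exact: c1| | |split;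
  first exact: hw].
- apply: (convergentM ca); apply: (convergent_scomp o1 ch) => i.
  by case: hPhi => /(_ i) [].
- by rewrite smul_coef0 (scomp_coef0 _ o1) mulf_neq0.
rewrite -he (pullback_scale _ _ o1); apply/funext => i.
by rewrite /scale_form mulrA.
Qed.

(** By the chain rule a right inverse has nonzero w-derivative too, so it has a right inverse in
    turn; by associativity that one is [psi], and the inverse is two-sided. *)
Lemma wmap_biholomorphism (psi : S) : convergent psi -> psi 0%MM = 0 ->
  psi U_(w)%MM != 0 ->
  exists phi : S, [/\ germ_biholomorphism (wmap phi), phi 0%MM = 0 &
    ssubst psi (wmap phi) = svar R N w].
Proof.
move=> cpsi psi0 psiw; have [phi [cphi phi0 e1]] := wmap_right_inverse cpsi psi0 psiw.
have gm (f : S) : convergent f -> f 0%MM = 0 -> germ_map (wmap f).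
  move=> cf f0 i; rewrite /wmap; case: ifP => // _; split; last by rewrite svar_coef0.
  exact: convergent_svar.
have o1 := wmap_order1 phi0; have o2 := wmap_order1 psi0.
have phiw : phi U_(w)%MM != 0.
  have : spder w (ssubst psi (wmap phi)) 0%MM = 1 by rewrite e1 sder_svar eqxx
    -scst_nat scst_coef eqxx.
  rewrite sder_scomp // ssum_coef (bigD1 w) //= big1 => [|i hi]; last first.
    by rewrite smul_coef0 wmap_z // sder_svar eq_sym (negPf hi) /= mulr0n szeroE mulr0.
  rewrite addr0 smul_coef0 wmap_w [X in _ * X]sder_coef mnm0E add0m.
  by move=> e; apply/eqP => z; move: e; rewrite z mul0rn mulr0 => /eqP;
    rewrite eq_sym oner_eq0.
have [chi [cchi chi0 e2]] := wmap_right_inverse cphi phi0 phiw.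
have o3 := wmap_order1 chi0.
have e3 : psi = chi.
  have : ssubst (ssubst psi (wmap phi)) (wmap chi) = psi.
    by rewrite scompA // wmap_comp // e2 wmap_id scomp_id.
  by rewrite e1 scomp_svar // wmap_w => ->.
exists phi; split=> //; apply/germ_biholomorphismP; split; first exact: gm.
exists (wmap psi); first exact: gm.
by rewrite !wmap_comp // e1 e3 e2 wmap_id.
Qed.

Lemma sum_sder_wmap (F : 'I_N -> S) (phi : S) j :
  \sum_i F i * spder j (wmap phi i) =
  (if j == w then 0 else F j) + F w * spder j phi.
Proof.
rewrite (bigD1 w) //= wmap_w addrC; congr (_ + _).
under eq_bigr => i hi do rewrite wmap_z // sder_svar.
case: eqP => [->|/eqP hj].
  by rewrite big1 // => i hi; rewrite eq_sym (negPf hi) mulr0.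
rewrite (bigD1 j) //= eqxx mulr1 big1 ?addr0 // => i /andP[_ hi].
by rewrite eq_sym (negPf hi) mulr0.
Qed.

(* In the coordinates (z, psi) the form [h theta] becomes
   [w dw + sum (h theta_i - psi d_i psi) dz_i]. *)
Lemma straighten theta (psi h : S) :
  (forall i, convergent (theta i)) -> integrable_form theta ->
  convergent psi -> psi 0%MM = 0 -> psi U_(w)%MM != 0 -> convergent h -> h 0%MM != 0 ->
  h * theta w = psi * spder w psi ->
  exists2 phi : S, phi 0%MM = 0 & exists Omega : oneform R N,
  [/\ forall i, convergent (Omega i), integrable_form Omega,
      Omega w = svar R N w,
      forall i, i != w -> Omega i = ssubst (h * theta i - psi * spder i psi) (wmap
        phi) &
      [/\ ssubst psi (wmap phi) = svar R N w & normalizable Omega ->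
        normalizable theta]].
Proof.
move=> ct it cpsi psi0 psiw ch h0 hE.
have [phi [bphi phi0 e1]] := wmap_biholomorphism cpsi psi0 psiw.
have o1 := wmap_order1 phi0; have gphi : germ_map (wmap phi) by case: bphi.
have chP : convergent (ssubst h (wmap phi)).
  by apply: convergent_scomp => // i; case: (gphi i).
exists phi => //; exists (scale_form (ssubst h (wmap phi)) (pullback (wmap phi)
  theta)); split.
- by move=> i; apply: convergentM => //; apply: convergent_pullback.
- by apply: integrable_scale; apply: integrable_pullback.
- rewrite /scale_form pullbackE sum_sder_wmap eqxx add0r mulrA -scompM // hE scompM
  // e1.
  (* The w-derivative of psi(z, phi) = w says that the two Jacobian factors cancel. *)
  have := congr1 (spder w) e1; rewrite sder_scomp // sum_sder_wmap eqxx add0r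
    sder_svar eqxx.
  by rewrite -mulrA => ->; rewrite mulr1.
- move=> i hi; rewrite /scale_form pullbackE sum_sder_wmap (negPf hi) mulrDr mulrA
  -!scompM //.
  rewrite hE scompB !scompM // e1.
  (* The derivative of psi(z, phi) = w along z_i converts the contribution of d_i phi into - psi d_i
     psi. *)
  have := congr1 (spder i) e1; rewrite sder_scomp // sum_sder_wmap (negPf hi)
    sder_svar (negPf hi).
  move=> /(congr1 (fun s : S => svar R N w * s)); rewrite mulr0 mulrDr.
  by move=> /eqP; rewrite addr_eq0 => /eqP ->; rewrite opprK mulrA.
split; first exact: e1.
move=> hn; apply: (normalizable_pullback bphi); apply: (normalizable_scale chP _ hn).
by rewrite (scomp_coef0 _ o1).
Qed.

End Normalizable.

(** * Normalising the radial contraction *)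

Lemma leq_bin_shift a b p q : (q <= p)%N -> ('C(a, b) <= 'C(a + p, b + q))%N.
Proof.
elim: p q => [|p ih] [|q] //; rewrite ?addn0 //.
  by move=> _; have := ih 0%N isT; rewrite addn0 addnS => h;
    apply: leq_trans h (leq_bin2l _ (leqnSn _)).
rewrite ltnS => /ih h; rewrite !addnS binS; apply: leq_trans h (leq_addl _ _).
Qed.

(** One term of Vandermonde's sum; this is what makes the inverse binomial weights
    submultiplicative. *)
Lemma bin_mul_leq a b c d : ('C(a, b) * 'C(c, d) <= 'C(a + c, b + d))%N.
Proof.
rewrite -binomial.Vandermonde.
have hb : (b < (b + d).+1)%N by rewrite ltnS leq_addr.
by rewrite (bigD1 (Ordinal hb)) //= addKn leq_addr.
Qed.

Lemma bin_leq_exp2 a b : ('C(a, b) <= 2 ^ a)%N.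
Proof.
elim: a b => [|a ih] [|b]; rewrite ?bin0 ?expn_gt0 // binS expnS mul2n -addnn.
exact: leq_add.
Qed.

(** The balance of gains and losses for a product of monomials of bidegrees (k1, j1) and (k2, j2).
    The derivative's factor is absorbed by raising both binomial indices by one; the remaining
    shifts, 3 k1 + j1 - 3 above and k1 - 1 below, are admissible because k1 > 0. *)
Lemma bin_deriv_leq k1 k2 j1 j2 : (0 < k1)%N -> (2 <= j1 + j2)%N ->
  (j2.+1 * 'C(3 * k2 + j2, k2) <=
   (k1 + k2) * 'C(3 * (k1 + k2) + (j1 + j2 - 2), k1 + k2))%N.
Proof.
move=> hk hj; apply: (@leq_trans ((3 * k2 + j2).+1 * 'C(3 * k2 + j2, k2))).
  by rewrite leq_mul2r; apply/orP; right; lia.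
rewrite mul_bin_diag; apply: leq_mul; first by lia.
have -> : (k1 + k2 = k2.+1 + k1.-1)%N by lia.
have -> : (3 * (k2.+1 + k1.-1) + (j1 + j2 - 2) = (3 * k2 + j2).+1 + (3 * k1 +
  j1 - 3))%N by lia.
by apply: leq_bin_shift; lia.
Qed.

Lemma bin_shift_leq k1 k2 j1 j2 : (0 < k1)%N -> (2 <= j1 + j2)%N ->
  ('C(3 * k2 + j2, k2) <= 'C(3 * (k1 + k2) + (j1 + j2 - 2), k1 + k2))%N.
Proof.
move=> hk hj.
have -> : (3 * (k1 + k2) + (j1 + j2 - 2) = (3 * k2 + j2) + (3 * k1 + j1 - 2))%N by lia.
by rewrite [(k1 + k2)%N]addnC; apply: leq_bin_shift; lia.
Qed.

(** * Degree in z, Euler operator, and expansion in powers of w *)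

Section ZDegree.
Variables (R : realType) (n : nat).
Local Notation N := n.+1.
Local Notation S := (series R N).
Local Notation w := (@ord_max n).
Implicit Types (a b : S) (m : 'X_{1..N}).

Definition zdeg m := (\sum_(i < N | i != w) m i)%N.

Lemma mdeg_zdeg m : mdeg m = (m w + zdeg m)%N.
Proof. by rewrite mdegE (bigD1 w). Qed.
Lemma zdegD m1 m2 : zdeg (m1 + m2)%MM = (zdeg m1 + zdeg m2)%N.
Proof. by rewrite /zdeg -big_split; apply: eq_bigr => i _; rewrite mnmDE. Qed.
Lemma zdegUw : zdeg U_(w)%MM = 0%N.
Proof. by rewrite /zdeg big1 // => i hi; rewrite mnm1E eq_sym (negPf hi). Qed.
Lemma zdeg0 : zdeg 0%MM = 0%N.
Proof. by rewrite /zdeg big1 // => i hi; rewrite mnm0E. Qed.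
Lemma zdegU i : i != w -> zdeg U_(i)%MM = 1%N.
Proof.
move=> hi; have := mdeg_zdeg U_(i)%MM; rewrite mdeg1 mnm1E (negPf hi) add0n.
by move=> <-.
Qed.

Definition zorder d a := forall m, (zdeg m < d)%N -> a m = 0.

Lemma zorder0 a : zorder 0 a. Proof. by []. Qed.
Lemma zorderD d a b : zorder d a -> zorder d b -> zorder d (a + b).
Proof. by move=> ha hb m hm; rewrite saddE ha // hb // addr0. Qed.
Lemma zorderN d a : zorder d a -> zorder d (- a).
Proof. by move=> ha m hm; rewrite soppE ha // oppr0. Qed.
Lemma zorderB d a b : zorder d a -> zorder d b -> zorder d (a - b).
Proof. by move=> ha hb; apply: zorderD => //; apply: zorderN. Qed.
Lemma zorderM d e a b : zorder d a -> zorder e b -> zorder (d + e) (a * b).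
Proof.
move=> ha hb m hm; rewrite (smul_sum _ _ (ltnSn _)) big1 // => -[k1 k2] /= /eqP em.
have hd : (zdeg k1 + zdeg k2 < d + e)%N by rewrite -zdegD -em.
case: (ltnP (zdeg k1) d) => h; first by rewrite ha ?mul0r.
by rewrite hb ?mulr0 //; lia.
Qed.
Lemma zorderMl d a b : zorder d a -> zorder d (a * b).
Proof. by move=> ha; rewrite -[d]addn0; apply: zorderM. Qed.
Lemma zorderMr d a b : zorder d b -> zorder d (a * b).
Proof. by rewrite mulrC; apply: zorderMl. Qed.

Definition zeuler a : S := fun m => a m *+ zdeg m.
(* As [0^-1 = 0], this kills the part of degree 0 in z. *)
Definition zeuler_inv a : S := fun m => (zdeg m)%:R^-1 * a m.
Definition wshift a : S := fun m => a (m + U_(w))%MM.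
Definition atw0 a : S := fun m => if m w == 0%N then a m else 0.

Lemma wshiftK a : a = atw0 a + svar R N w * wshift a.
Proof.
apply/funext => m; rewrite saddE /atw0; case: eqP => [h|/eqP h].
  by rewrite smulX_coef0 // addr0.
have em : m = (m - U_(w) + U_(w))%MM by rewrite submK // lep1mP.
by rewrite add0r [in RHS]em smulX_coef /wshift -em.
Qed.

Lemma atw0_order d a : zorder d a -> zorder d (atw0 a).
Proof. by move=> h m hm; rewrite /atw0 h // if_same. Qed.
Lemma wshift_order d a : zorder d a -> zorder d (wshift a).
Proof. by move=> h m hm; rewrite /wshift h // zdegD zdegUw addn0. Qed.

Lemma atw0D a b : atw0 (a + b) = atw0 a + atw0 b.
Proof. by apply/funext => m; rewrite saddE /atw0 saddE; case: ifP; rewrite ?addr0. Qed.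
Lemma atw0N a : atw0 (- a) = - atw0 a.
Proof. by apply/funext => m; rewrite soppE /atw0 soppE; case: ifP; rewrite ?oppr0. Qed.
Lemma atw0M a b : atw0 (a * b) = atw0 a * atw0 b.
Proof.
apply/funext => m; rewrite /atw0; case: eqP => [h|/eqP h].
  rewrite !(smul_sum _ _ (ltnSn _)); apply: eq_bigr => -[k1 k2] /= /eqP em.
  move/(congr1 (fun k : 'X_{1..N} => k w)): (em); rewrite mnmDE h => /esym/eqP.
  by rewrite addn_eq0 => /andP[-> ->].
rewrite (smul_sum _ _ (ltnSn _)) big1 // => -[k1 k2] /= /eqP em.
have : (k1 w + k2 w != 0)%N by rewrite -mnmDE -em.
by rewrite addn_eq0 negb_and => /orP[] /negPf ->; rewrite ?mul0r ?mulr0.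
Qed.
Lemma atw0_1 : atw0 1 = 1.
Proof.
apply/funext => m; rewrite /atw0 sone_coef; case: (m =P 0%MM) => [->|_].
  by rewrite mnm0E.
by rewrite if_same.
Qed.
Lemma atw0_id a : atw0 (atw0 a) = atw0 a.
Proof. by apply/funext => m; rewrite /atw0; case: (m w == 0%N). Qed.
Lemma atw0_der a : spder w (atw0 a) = 0.
Proof.
apply/funext => m; rewrite sder_coef /atw0 mnmDE mnm1E eqxx addn1 /=.
by rewrite mul0rn.
Qed.

Lemma der_svar_mul a m : spder w (svar R N w * a) m = a m *+ (m w).+1.
Proof. by rewrite sder_coef smulX_coef. Qed.
Lemma atw0_der_svar_mul a : atw0 (spder w (svar R N w * a)) = atw0 a.
Proof.
by apply/funext => m; rewrite /atw0; case: eqP => // h; rewrite der_svar_mul h mulr1n.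
Qed.

Lemma zeulerK a : zorder 1 a -> zeuler (zeuler_inv a) = a.
Proof.
move=> h; apply/funext => m; rewrite /zeuler /zeuler_inv -[LHS]mulr_natr mulrC mulrA.
case: (posnP (zdeg m)) => h0; first by rewrite h0 invr0 mulr0 mul0r h // h0.
by rewrite mulfV ?mul1r // pnatr_eq0 -lt0n.
Qed.

Lemma svar_der_coef i a m : (svar R N i * spder i a) m = a m *+ m i.
Proof.
case: (posnP (m i)) => h; first by rewrite smulX_coef0 // h.
have em : m = (m - U_(i) + U_(i))%MM by rewrite submK // lep1mP -lt0n.
by rewrite [in LHS]em smulX_coef sder_coef -em mnmBE mnm1E eqxx subn1 prednK.
Qed.

Lemma zeulerE a : zeuler a = \sum_(i < N | i != w) svar R N i * spder i a.
Proof.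
apply/funext => m; rewrite ssum_coef /zeuler /zdeg -sumrMnr.
by apply: eq_bigr => i _; rewrite svar_der_coef.
Qed.

Lemma zeulerM a b : zeuler (a * b) = zeuler a * b + a * zeuler b.
Proof.
rewrite !zeulerE mulr_suml mulr_sumr -big_split; apply: eq_bigr => i _ /=.
by rewrite sderM; ring.
Qed.
Lemma zeuler_svar_w : zeuler (svar R N w) = 0.
Proof.
by rewrite zeulerE big1 // => i hi; rewrite sder_svar (negPf hi) mulr0.
Qed.

End ZDegree.

(** * Binomial weights *)

Section CauchyKovalevskaya.
Variables (R : realType) (n : nat).
Local Notation N := n.+1.
Local Notation S := (series R N).
Local Notation w := (@ord_max n).
Local Notation x := (svar R N w).
Implicit Types (a b : S) (m : 'X_{1..N}).

Section Weights.
Variables (s e : R).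
Hypotheses (s_gt0 : 0 < s) (e_gt0 : 0 < e).

Definition zw_weight m : R := e ^+ zdeg m * s ^+ m w.
Definition ck_weight m : R := zw_weight m / 'C(3 * zdeg m + m w, zdeg m)%:R.

Lemma bin_pos k j : 0 < 'C(3 * k + j, k)%:R :> R.
Proof. by rewrite ltr0n bin_gt0; lia. Qed.
Lemma zw_weight_ge0 m : 0 <= zw_weight m.
Proof. by rewrite mulr_ge0 // exprn_ge0 // ltW. Qed.
Lemma ck_weight_ge0 m : 0 <= ck_weight m.
Proof. by rewrite divr_ge0 ?zw_weight_ge0 // ltW // bin_pos. Qed.
Lemma zw_weightD m1 m2 : zw_weight (m1 + m2)%MM = zw_weight m1 * zw_weight m2.
Proof. by rewrite /zw_weight zdegD mnmDE !exprD mulrACA. Qed.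

Lemma ck_weight_multiplicative : multiplicative_weight ck_weight.
Proof.
split=> [||m1 m2].
- by rewrite /ck_weight /zw_weight zdeg0 mnm0E bin0 !expr0 mulr1 divr1.
- exact: ck_weight_ge0.
rewrite /ck_weight zw_weightD zdegD mnmDE [leRHS]mulrACA -invfM.
apply: ler_wpM2l; first by rewrite mulr_ge0 ?zw_weight_ge0.
rewrite lef_pV2 ?posrE ?mulr_gt0 ?bin_pos // -natrM ler_nat.
apply: leq_trans (bin_mul_leq _ _ _ _) _.
by rewrite (_ : 3 * zdeg m1 + m1 w + (3 * zdeg m2 + m2 w) =
   3 * (zdeg m1 + zdeg m2) + (m1 w + m2 w))%N //; lia.
Qed.

(* The least weights for which division by w^2, followed for [euler_weight] by the
   inverse of the Euler operator, is a contraction into [ck_weight]. *)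
Definition wshift2_weight m : R :=
  if (m w < 2)%N then 0 else ck_weight (m - (U_(w) + U_(w)))%MM.
Definition euler_weight m : R := wshift2_weight m / (zdeg m)%:R.

Lemma wshift2_weight_ge0 m : 0 <= wshift2_weight m.
Proof. by rewrite /wshift2_weight; case: ifP => // _; apply: ck_weight_ge0. Qed.

Lemma wshift2_weightE m : (2 <= m w)%N -> wshift2_weight m =
  s ^- 2 * zw_weight m / 'C(3 * zdeg m + (m w - 2), zdeg m)%:R.
Proof.
move=> h; rewrite /wshift2_weight ltnNge h /=.
have em : m = (m - (U_(w) + U_(w)) + (U_(w) + U_(w)))%MM.
  rewrite submK //; apply/mnm_lepP => i; rewrite mnmDE !mnm1E.
  by case: eqP => // <-.
set k := (m - _)%MM in em *.
have zk : zdeg k = zdeg m by rewrite em !zdegD zdegUw !addn0.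
have wk : k w = (m w - 2)%N by rewrite em !mnmDE !mnm1E eqxx addnK.
rewrite /ck_weight zk wk; congr (_ / _); rewrite /zw_weight zk wk mulrCA; congr (_ * _).
by rewrite -{2}(subnK h) exprD mulrCA mulVf ?mulr1 // expf_neq0 // gt_eqF.
Qed.

(** For the term A/v, which carries no derivative. The first factor is measured without binomials,
    so the condition on f is plain smallness on a polydisc. *)
Lemma wshift2_weightM m1 m2 : (0 < zdeg m1)%N ->
  wshift2_weight (m1 + m2)%MM <= s ^- 2 * zw_weight m1 * ck_weight m2.
Proof.
move=> h; have g0 : 0 <= s ^- 2 by rewrite invr_ge0 exprn_ge0 // ltW.
case: (ltnP ((m1 + m2)%MM w) 2) => h2.
  rewrite /wshift2_weight h2.
  exact: mulr_ge0 (mulr_ge0 g0 (zw_weight_ge0 _)) (ck_weight_ge0 _).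
rewrite wshift2_weightE // zw_weightD /ck_weight.
move: (zw_weight m1) (zw_weight m2) (zw_weight_ge0 m1) (zw_weight_ge0 m2) => u v u0 v0.
rewrite -!mulrA; do 3 (apply: ler_wpM2l => //).
rewrite lef_pV2 ?posrE ?bin_pos // ler_nat zdegD mnmDE.
by apply: bin_shift_leq => //; rewrite -mnmDE.
Qed.

(** For the term with (w v)': differentiation multiplies the coefficient of v at [m2] by
    [(m2 w).+1], which the weight of the second factor cancels exactly. *)
Lemma euler_weightM m1 m2 : (0 < zdeg m1)%N ->
  euler_weight (m1 + m2)%MM <=
  s ^- 2 * zw_weight m1 * (ck_weight m2 / (m2 w).+1%:R).
Proof.
move=> h; have g0 : 0 <= s ^- 2 by rewrite invr_ge0 exprn_ge0 // ltW.
rewrite /euler_weight; case: (ltnP ((m1 + m2)%MM w) 2) => h2.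
  rewrite /wshift2_weight h2 mul0r; apply: mulr_ge0.
    exact: mulr_ge0 g0 (zw_weight_ge0 _).
  by apply: divr_ge0; [apply: ck_weight_ge0 | apply: ler0n].
rewrite wshift2_weightE // zw_weightD /ck_weight.
move: (zw_weight m1) (zw_weight m2) (zw_weight_ge0 m1) (zw_weight_ge0 m2) => u v u0 v0.
rewrite -!mulrA; do 3 (apply: ler_wpM2l => //).
have zp : (0 < zdeg (m1 + m2)%MM)%N by rewrite zdegD addn_gt0 h.
rewrite -!invfM lef_pV2 ?posrE ?mulr_gt0 ?bin_pos ?ltr0n //.
rewrite -!natrM ler_nat [X in (_ <= X)%N]mulnC [X in (X <= _)%N]mulnC zdegD mnmDE.
by apply: bin_deriv_leq => //; rewrite -mnmDE.
Qed.

Definition wshift2 a : S := wshift (wshift a).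

Lemma norm_le_wshift2 a A : norm_le wshift2_weight a A ->
  norm_le ck_weight (zeuler_inv (wshift2 a)) A.
Proof.
apply: (@norm_le_inj _ _ _ _ (fun m => m + (U_(w) + U_(w)))%MM) => [|m];
  first exact: addIm.
rewrite /wshift2_weight !mnmDE !mnm1E eqxx addnA addn1 addnS addmK /=.
rewrite /zeuler_inv /wshift2 /wshift -addmA Normc.normcM -mulrA; apply: ler_piMl.
  by rewrite mulr_ge0 ?ck_weight_ge0 ?normc_ge0.
rewrite Normc.normcV normc_nat; case: (zdeg m) => [|k]; first by rewrite invr0.
by rewrite invf_le1 ?ltr0n // ler1n.
Qed.

Lemma norm_le_euler a A : norm_le euler_weight a A ->
  norm_le ck_weight (zeuler_inv (wshift2 a)) A.
Proof.
apply: (@norm_le_inj _ _ _ _ (fun m => m + (U_(w) + U_(w)))%MM) => [|m];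
  first exact: addIm.
rewrite /euler_weight /wshift2_weight !mnmDE !mnm1E eqxx addnA addn1 addnS addmK /=.
rewrite /zeuler_inv /wshift2 /wshift -addmA Normc.normcM !zdegD zdegUw !addn0.
move: (ck_weight m) => c.
by rewrite Normc.normcV normc_nat mulrA [X in _ <= X]mulrC mulrA.
Qed.

End Weights.

Lemma norm_le_atw0 (wt : 'X_{1..N} -> R) a A : (forall m, 0 <= wt m) ->
  norm_le wt a A -> norm_le wt (atw0 a) A.
Proof.
move=> w0; apply: (@norm_le_inj _ _ _ _ id) => // m; rewrite /atw0; case: ifP => // _.
by rewrite Normc.normc0 mul0r mulr_ge0 ?normc_ge0.
Qed.

End CauchyKovalevskaya.

(** * Existence and convergence of the solution v *)

Section Solution.
Variables (R : realType) (n : nat).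
Local Notation N := n.+1.
Local Notation S := (series R N).
Local Notation w := (@ord_max n).
Local Notation x := (svar R N w).
Implicit Types (a b : S) (m : 'X_{1..N}).

Lemma norm_le_scale (wt : 'X_{1..N} -> R) a A c : 0 <= c ->
  norm_le wt a A -> norm_le (fun m => c * wt m) a (c * A).
Proof.
move=> c0 h s us; apply: le_trans (ler_wpM2l c0 (h s us)).
by rewrite mulr_sumr; apply: ler_sum => m _; rewrite mulrCA.
Qed.

Lemma zorder_zeuler_inv d a : zorder d a -> zorder d (zeuler_inv a).
Proof. by move=> h m hm; rewrite /zeuler_inv h // mulr0. Qed.
Lemma zorder1_zeuler_inv a : zorder 1 (zeuler_inv a).
Proof. by move=> m; rewrite /zeuler_inv ltnS leqn0 => /eqP ->; rewrite invr0 mul0r. Qed.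
Lemma zorder_wshift2 d a : zorder d a -> zorder d (wshift2 a).
Proof. by move=> h; do 2 apply: wshift_order. Qed.
Lemma zeuler_invB a b : zeuler_inv (a - b) = zeuler_inv a - zeuler_inv b.
Proof. by apply/funext => m; rewrite ssubE /zeuler_inv ssubE mulrBr. Qed.
Lemma wshift2B a b : wshift2 (a - b) = wshift2 a - wshift2 b.
Proof. by []. Qed.
Lemma zeulerD a b : zeuler (a + b) = zeuler a + zeuler b.
Proof. by apply/funext => m; rewrite saddE /zeuler saddE mulrnDl. Qed.
Lemma zeuler1 : zeuler (1 : S) = 0.
Proof.
apply/funext => m; rewrite /zeuler sone_coef szeroE; case: eqP => [->|_];
  last by rewrite mul0rn.
by rewrite zdeg0 mulr0n.
Qed.

Section Iteration.
Variable f : S.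
Hypothesis f_order : zorder 1 f.

(* [p] stands for [1 / v], and [atw0 f * atw0 v ^+ 2] for the function A(z) that
   makes [ck_rhs] vanish on w = 0.  Dropping the terms of degree < 2 in w, as
   [wshift2] does, absorbs the unknown B(z). *)
Definition ck_rhs (v p : S) : S := f * spder w (x * v) - atw0 f * atw0 v ^+ 2 * p.
Definition ck_step (v p : S) : S := 1 + zeuler_inv (wshift2 (ck_rhs v p)).

Lemma ck_rhs_order v p : zorder 1 (ck_rhs v p).
Proof.
apply: zorderB; first exact: zorderMl.
by rewrite -mulrA; apply: zorderMl; apply: atw0_order.
Qed.

(** The gain of one order comes from the factors f and [atw0 f], which vanish on z = 0; d/dw and
    restriction to w = 0 do not lower the order in z. *)
Lemma ck_rhs_sub k v p v' p' : zorder k (v - v') -> zorder k (p - p') ->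
  zorder k.+1 (ck_rhs v p - ck_rhs v' p').
Proof.
move=> hv hp.
have -> : ck_rhs v p - ck_rhs v' p' = f * spder w (x * (v - v')) -
    atw0 f * (atw0 v ^+ 2 * (p - p') + atw0 (v - v') * (atw0 v + atw0 v') * p').
  rewrite /ck_rhs mulrBr sderB atw0D atw0N; ring.
rewrite -[k.+1]add1n; apply: zorderB; apply: zorderM => //.
- by move=> m hm; rewrite der_svar_mul hv // mul0rn.
- exact: atw0_order.
apply: zorderD; first exact: zorderMr.
by rewrite -mulrA; apply: zorderMl; apply: atw0_order.
Qed.

Lemma ck_step_sub k v p v' p' : zorder k (v - v') -> zorder k (p - p') ->
  zorder k.+1 (ck_step v p - ck_step v' p').
Proof.
move=> hv hp; rewrite /ck_step opprD addrACA subrr add0r -zeuler_invB -wshift2B.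
by apply: zorder_zeuler_inv; apply: zorder_wshift2; apply: ck_rhs_sub.
Qed.

Lemma ck_step_order v p : zorder 1 (ck_step v p - 1).
Proof. by rewrite /ck_step addrC addKr; apply: zorder1_zeuler_inv. Qed.

Section Bound.
Variables (s e : R).
Hypotheses (s_gt0 : 0 < s) (e_gt0 : 0 < e).
Hypothesis f_small : norm_le (fun m => s ^- 2 * zw_weight s e m) f 12^-1.
Local Notation ck := (@ck_weight R n s e).

Lemma norm_le_near1 v : norm_le ck (v - 1) 2^-1 -> norm_le ck v (3 / 2).
Proof.
move=> h; have -> : v = (v - 1) + 1 by rewrite subrK.
have -> : 3 / 2 = 2^-1 + 1 :> R by lra.
apply: norm_leD => //; first exact: ck_weight_ge0.
by apply: norm_le1; case: (@ck_weight_multiplicative R n s e s_gt0 e_gt0).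
Qed.

(** Origin of the constant 1/12: with v of norm at most 3/2 and p of norm at most 2, the two terms
    contribute 1/12 times 3/2 and 1/12 times (3/2)^2 times 2, that is 1/8 + 3/8 = 1/2. *)
Lemma ck_step_bound v p : norm_le ck (v - 1) 2^-1 -> norm_le ck p 2 ->
  norm_le ck (ck_step v p - 1) 2^-1.
Proof.
move=> /norm_le_near1 hv hp; have mw := @ck_weight_multiplicative R n s e s_gt0 e_gt0.
have ck0 := @ck_weight_ge0 R n s e s_gt0 e_gt0.
have g0 m : 0 <= s ^- 2 * zw_weight s e m.
  by apply: mulr_ge0 (zw_weight_ge0 s_gt0 e_gt0 m); rewrite invr_ge0 exprn_ge0 // ltW.
rewrite /ck_step addrC addKr /ck_rhs wshift2B zeuler_invB.
have -> : 2^-1 = 12^-1 * (3 / 2) + 12^-1 * ((3 / 2) ^+ 2 * 2) :> R by lra.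
apply: norm_leB => //.
- apply: norm_le_euler.
  apply: (norm_leM g0 (w1 := fun m => ck m / (m w).+1%:R)) f_small _ =>
    [m|m|m1 m2 hm1|].
  + by apply: divr_ge0 (ck0 m) _; apply: ler0n.
  + apply: divr_ge0; last exact: ler0n.
    exact: wshift2_weight_ge0.
  + apply: euler_weightM => //; rewrite lt0n; apply: contra hm1 => /eqP h.
    by rewrite f_order ?h.
  apply: (@norm_le_inj _ _ _ _ id) hv => // m.
  rewrite der_svar_mul normcMn; move: (normc _) (ck m) => c u.
  have k0 : (m w).+1%:R != 0 :> R by rewrite pnatr_eq0.
  by rewrite -[c *+ _]mulr_natr mulrACA mulfV // mulr1.
apply: (norm_le_wshift2 s_gt0 e_gt0); rewrite -mulrA.
apply: (norm_leM g0 ck0) => [m|m1 m2 hm1||].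
- exact: wshift2_weight_ge0.
- apply: wshift2_weightM => //; rewrite lt0n; apply: contra hm1 => /eqP h.
  by rewrite (atw0_order f_order) ?h.
- exact: norm_le_atw0.
apply: norm_leMm => //; apply: norm_leX => //; exact: norm_le_atw0.
Qed.

Lemma ck_inv_bound v p : norm_le ck (v - 1) 2^-1 -> norm_le ck p 2 ->
  norm_le ck (1 - (v - 1) * p) 2.
Proof.
move=> hv hp; have mw := @ck_weight_multiplicative R n s e s_gt0 e_gt0.
have -> : 2 = 1 + 2^-1 * 2 :> R by lra.
apply: norm_leB; [exact: ck_weight_ge0 | | exact: norm_leMm].
by apply: norm_le1; case: mw.
Qed.

Lemma ck_fixed_point : exists v p : S,
  [/\ v = ck_step v p, p = 1 - (v - 1) * p & norm_le ck v (3 / 2)].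
Proof.
(* The inverse p of v is iterated along with v. Its update uses the new v: that one already agrees
   to order k + 1, and [v - 1] vanishes on z = 0, so p also gains an order. With the old v it would
   not. *)
pose T (st : bool -> S) : bool -> S := fun c : bool =>
  let v := ck_step (st true) (st false) in if c then v else 1 - (v - 1) * st false.
pose inv (st : bool -> S) :=
  [/\ zorder 1 (st true - 1), norm_le ck (st true - 1) 2^-1 & norm_le ck (st false) 2].
have [||k y z [y1 _ _] [z1 _ _] hyz|y hy|y [y1 ny np] fy] :=
    @fixed_point R N bool (@zdeg n) T inv (fun _ => 1).
- split; rewrite ?subrr; first by [].
    by apply: norm_le_mono (norm_le0 _); rewrite invr_ge0.
  apply: norm_le_mono (norm_le1 _); first by lra.
  by case: (@ck_weight_multiplicative R n s e s_gt0 e_gt0).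
- move=> y [y1 ny np]; split; rewrite /T /=.
  + exact: ck_step_order.
  + exact: ck_step_bound.
  + by apply: ck_inv_bound => //; apply: ck_step_bound.
- have ag (c : bool) : zorder k (y c - z c) by move=> m hm; rewrite ssubE hyz // subrr.
  have h1 := ck_step_sub (ag true) (ag false).
  have sub0 (a b : S) : zorder k.+1 (a - b) -> forall m, (zdeg m < k.+1)%N -> a m = b m.
    by move=> h m hm; apply/eqP; rewrite -subr_eq0 -ssubE h.
  move=> [] m hm; rewrite /T; apply: (sub0 _ _ _ m hm); first exact: h1.
  set v := ck_step _ _ in h1 *; set v' := ck_step _ _ in h1 *.
  have -> : 1 - (v - 1) * y false - (1 - (v' - 1) * z false) =
    - ((v - 1) * (y false - z false) + (v - v') * z false) by ring.
  apply: zorderN; apply: zorderD; last exact: zorderMl.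
  by rewrite -[k.+1]add1n; apply: zorderM => //; apply: ck_step_order.
- split.
  + move=> m hm; have [z [z1 _ _] hz] := hy 1%N.
    by rewrite ssubE hz // -ssubE z1.
  + apply: norm_le_approx => l; have [d hd] := seq_mdeg_bound l.
    have [z [_ nz _] hz] := hy d; exists (z true - 1) => // m hm.
    by rewrite !ssubE hz //; have := hd m hm; rewrite mdeg_zdeg; lia.
  + apply: norm_le_approx => l; have [d hd] := seq_mdeg_bound l.
    have [z [_ _ nz] hz] := hy d; exists (z false) => // m hm.
    by rewrite hz //; have := hd m hm; rewrite mdeg_zdeg; lia.
have fv := congr1 (fun st => st true) fy; have fp := congr1 (fun st => st false) fy.
rewrite /T /= in fv fp; exists (y true), (y false); split; first by rewrite fv.
  by rewrite -[in RHS]fv fp.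
exact: norm_le_near1.
Qed.

End Bound.
End Iteration.

Theorem ck_solution f : convergent f -> zorder 1 f -> exists v p : S,
  [/\ convergent v, zorder 1 (v - 1), v * p = 1 & zeuler v = wshift2 (ck_rhs f v p)].
Proof.
move=> /convergentP [r r0 [A hA]] f1; have A0 := norm_le_ge0 hA.
have ri0 : 0 <= r ^- 2 by rewrite invr_ge0 exprn_ge0 // ltW.
pose B := r ^- 2 * A; have B0 : 0 <= B by apply: mulr_ge0.
have B1 : 0 < B + 1 by apply: ltr_wpDl.
(* The radii are [r] in w and [t * r] in z. As f has order 1 in z, its norm gains a factor [t], and
   [t * B] is at most 1/12. *)
pose t := (12 * (B + 1))^-1.
have t0 : 0 < t by rewrite invr_gt0 mulr_gt0.
have t1 : t <= 1.
  rewrite invf_le1 ?mulr_gt0 //; lra.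
have tB : t * B <= 12^-1.
  rewrite /t invfM -mulrA; apply: ler_piMr; first by rewrite invr_ge0.
  by rewrite mulrC ler_pdivrMr // mul1r lerDl.
have e0 : 0 < t * r by rewrite mulr_gt0.
have fs : norm_le (fun m => r ^- 2 * zw_weight r (t * r) m) f 12^-1.
  apply: (@norm_le_mono _ _ _ _ (r ^- 2 * (t * A))); first by rewrite mulrCA.
  apply: (norm_le_scale ri0); apply: (@norm_le_inj _ _ _ _ id) (norm_le_scale (ltW
    t0) hA) => // m.
  case: (posnP (zdeg m)) => hm; first by rewrite f1 ?hm // Normc.normc0 !mul0r.
  apply: ler_wpM2l; first exact: normc_ge0.
  rewrite /zw_weight /rweight mdeg_zdeg addnC exprD exprMn -mulrA.
  apply: ler_wpM2r; first by rewrite mulr_ge0 // exprn_ge0 // ltW.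
  by rewrite -(prednK hm) exprS ler_piMr ?(ltW t0) // exprn_ile1 // ltW.
have [v [p [ev ep nv]]] := ck_fixed_point f1 r0 e0 fs.
exists v, p; split.
(* Back to a polydisc: binomial(3k + j, k) is at most 2^(3k + j), hence at most 8^(k + j). *)
- apply/convergentP; exists (t * r / 8); first by rewrite divr_gt0.
  exists (3 / 2); apply: norm_le_weight nv => m.
  rewrite /rweight /ck_weight /zw_weight expr_div_n.
  have tr_ge0 : 0 <= t * r by apply: ltW.
  apply: ler_pM; rewrite ?exprn_ge0 ?invr_ge0 ?exprn_ge0 //.
    rewrite mdeg_zdeg addnC exprD; apply: ler_wpM2l; first exact: exprn_ge0.
    by apply: lerXn2r; rewrite ?nnegrE ?(ltW r0) // ler_piMl // ltW.
  have cpos : 0 < 'C(3 * zdeg m + m w, zdeg m)%:R :> R by apply: bin_pos.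
  rewrite lef_pV2 ?posrE ?exprn_gt0 //.
  have -> : 8 = (2 ^ 3)%:R :> R by [].
  rewrite -natrX ler_nat; apply: leq_trans (bin_leq_exp2 _ _) _.
  rewrite -expnM; apply: leq_pexp2l => //.
  by rewrite mdeg_zdeg mulnDr addnC leq_add2r leq_pmull.
- by rewrite ev; apply: ck_step_order.
- by have : p + (v - 1) * p = 1; [rewrite {1}ep subrK | move=> <-; ring].
rewrite [in LHS]ev /ck_step zeulerD zeuler1 add0r zeulerK //.
by apply: zorder_wshift2; apply: ck_rhs_order.
Qed.

End Solution.

(** * Coefficients affine in the last variable *)

Section WFree.
Variables (R : realType) (n : nat).
Local Notation N := n.+1.
Local Notation S := (series R N).
Local Notation w := (@ord_max n).
Local Notation x := (svar R N w).
Implicit Types (a b c : S) (m : 'X_{1..N}).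

Lemma smulrn_eq0 a k : a *+ k.+1 = 0 -> a = 0.
Proof.
move=> h; apply/funext => m; have := congr1 (fun s : S => s m) h.
by rewrite smulrn_coef szeroE => /eqP; rewrite mulrn_eq0 => /eqP.
Qed.

Lemma wfree_coef a m : spder w a = 0 -> m w != 0%N -> a m = 0.
Proof.
move=> h hm; have := svar_der_coef w a m; rewrite h mulr0 szeroE => /esym/eqP.
by rewrite mulrn_eq0 (negPf hm) => /eqP.
Qed.

Lemma wfree_subst a (phi : S) : phi 0%MM = 0 -> spder w a = 0 ->
  ssubst a (wmap phi) = a.
Proof.
move=> h0 ha; rewrite -[RHS]scomp_id; apply/funext => m.
have o1 := wmap_order1 h0.
rewrite [LHS](@scomp_sumE _ _ _ _ _ _ _ o1 (ltnSn _)).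
rewrite [RHS](@scomp_sumE _ _ _ _ _ _ _ (@svar_order1 R N) (ltnSn _)).
congr (_ m); apply: eq_bigr => k _; case: (posnP (k w)) => hk; last first.
  by rewrite (@wfree_coef a k) ?scst0 ?mul0r // -lt0n.
apply: congr1; apply: eq_bigr => i _; have [->|hi] := eqVneq i w.
  by rewrite hk !expr0.
by rewrite wmap_z.
Qed.

Lemma der_wx : spder w x = 1. Proof. by rewrite sder_svar eqxx. Qed.
Lemma der_zx i : i != w -> spder i x = 0.
Proof. by move=> hi; rewrite sder_svar (negPf hi). Qed.

Lemma wfree_poly2 a b c : spder w a = 0 -> spder w b = 0 -> spder w c = 0 ->
  a + x * b + x ^+ 2 * c = 0 -> [/\ a = 0, b = 0 & c = 0].
Proof.
move=> ha hb hc h.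
have h1 : b + x * c *+ 2 = 0.
  rewrite -[RHS](sder0 _ w) -h !sderD sderM exprS expr1 !sderM ha hb hc der_wx; ring.
have c0 : c = 0.
  apply: (@smulrn_eq0 c 1); rewrite -[RHS](sder0 _ w) -h1 sderD hb mulr2n sderD
    !sderM hc der_wx.
  by ring.
have b0 : b = 0 by rewrite c0 mulr0 mul0rn addr0 in h1.
by split=> //; rewrite b0 c0 !mulr0 !addr0 in h.
Qed.

Lemma zeuler_der_w a : spder w (zeuler a) = zeuler (spder w a).
Proof.
apply/funext => m; rewrite sder_coef /zeuler sder_coef zdegD zdegUw addn0.
by rewrite -!mulrnA mulnC.
Qed.

Lemma zeuler_inv_der_w a : spder w (zeuler_inv a) = zeuler_inv (spder w a).
Proof.
apply/funext => m; rewrite sder_coef /zeuler_inv sder_coef zdegD zdegUw addn0.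
by rewrite mulrnAr.
Qed.

Lemma zeuler_der_z i a : i != w -> spder i (zeuler a) = zeuler (spder i a) + spder i a.
Proof.
move=> hi; apply/funext => m; rewrite saddE sder_coef /zeuler !sder_coef zdegD zdegU
  // addn1.
by rewrite -!mulrnA -mulrnDr; congr (_ *+ _); rewrite mulnC mulnS addnC.
Qed.

Lemma zeuler1_inj a : zeuler a + a = 0 -> a = 0.
Proof.
move=> h; apply/funext => m; have := congr1 (fun s : S => s m) h.
by rewrite saddE /zeuler -mulrSr szeroE => /eqP; rewrite mulrn_eq0 => /eqP.
Qed.

Lemma zeuler_inv_convergent a : convergent a -> convergent (zeuler_inv a).
Proof.
move=> /convergentP [r r0 [A hA]]; apply/convergentP; exists r => //; exists A.
apply: (@norm_le_inj _ _ _ _ id) hA => // m.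
apply: ler_wpM2r; first by rewrite exprn_ge0 // ltW.
rewrite /zeuler_inv Normc.normcM Normc.normcV normc_nat;
  apply: ler_piMl (normc_ge0 _) _.
case: (zdeg m) => [|k]; first by rewrite invr0.
by rewrite invf_le1 ?ltr0n // ler1n.
Qed.

Definition zradial (F : oneform R N) : S := \sum_(i < N | i != w) svar R N i * F i.

Lemma zradial_order (F : oneform R N) : zorder 1 (zradial F).
Proof.
move=> m hm; rewrite /zradial ssum_coef big1 // => i hi.
suff h : zorder 1 (svar R N i : S) by apply: (@zorderMl _ _ 1 _ (F i) h m hm).
move=> k; rewrite ltnS leqn0 => /eqP hk; rewrite svar_coef; case: eqP => // ek.
by move: hk; rewrite ek zdegU.
Qed.

Lemma sder_zradial (F : oneform R N) j : j != w ->
  spder j (zradial F) = F j + \sum_(i < N | i != w) svar R N i * spder j (F i).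
Proof.
move=> hj; rewrite /zradial sder_sum.
have -> : F j = \sum_(i < N | i != w) (j == i)%:R * F i.
  rewrite (bigD1 j) //= eqxx mul1r big1 ?addr0 // => i /andP[_ hi].
  by rewrite eq_sym (negPf hi) mul0r.
rewrite -big_split; apply: eq_bigr => i hi /=.
by rewrite sderM sder_svar.
Qed.

Lemma sder_w_zradial (F : oneform R N) :
  spder w (zradial F) = \sum_(i < N | i != w) svar R N i * spder w (F i).
Proof.
rewrite /zradial sder_sum; apply: eq_bigr => i hi /=.
by rewrite sderM sder_svar eq_sym (negPf hi) mul0r add0r.
Qed.

(** The primitive is the inverse Euler operator applied to the radial contraction. Closedness gives
    (E + 1)(d_j f - F_j) = 0, and E + 1 is injective. *)
Lemma poincare (F : oneform R N) :
  (forall i, i != w -> convergent (F i)) -> (forall i, i != w -> spder w (F i) = 0) ->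
  (forall i j, i != w -> j != w -> spder i (F j) = spder j (F i)) ->
  exists f : S, [/\ convergent f, spder w f = 0 & forall j, j != w -> spder j f = F j].
Proof.
move=> cF wF closedF; exists (zeuler_inv (zradial F)); split.
- apply: zeuler_inv_convergent; rewrite /zradial -big_filter.
  have : all (fun i => i != w) [seq i <- index_enum 'I_N | i != w] by apply: filter_all.
  elim: [seq i <- _ | _] => [|i s ih] /=; first by rewrite big_nil; move=> _;
    apply: convergent0.
  move=> /andP[hi hs]; rewrite big_cons; apply: convergentD (ih hs).
  by apply: convergentM; [apply: convergent_svar | apply: cF].
- rewrite zeuler_inv_der_w sder_w_zradial big1 => [|i hi]; last by rewrite wF // mulr0.
  by apply/funext => m; rewrite /zeuler_inv szeroE mulr0.
move=> j hj; set f := zeuler_inv _.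
have hE : zeuler f = zradial F by apply: zeulerK; apply: zradial_order.
apply/eqP; rewrite -subr_eq0; apply/eqP/zeuler1_inj.
have := zeuler_der_z f hj; rewrite hE sder_zradial //.
under eq_bigr => i hi do rewrite closedF //.
rewrite -zeulerE => h.
have zB : zeuler (spder j f - F j) = zeuler (spder j f) - zeuler (F j).
  by apply/funext => m; rewrite ssubE /zeuler ssubE mulrnBl.
rewrite zB; have -> : zeuler (spder j f) - zeuler (F j) + (spder j f - F j) =
  zeuler (spder j f) + spder j f - (F j + zeuler (F j)) by ring.
by rewrite -h subrr.
Qed.

Section Affine.
Variables (Omega : oneform R N) (A B : S).
Hypotheses (Omega_int : integrable_form Omega) (Omega_w : Omega w = x).
Hypotheses (A_w : spder w A = 0) (B_w : spder w B = 0).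
Hypotheses (A_order : zorder 1 A) (B_order : zorder 1 B).
Hypothesis Omega_rad : zradial Omega = A + x * B.

Lemma integrable_w i j : i != w -> j != w ->
  x * (spder i (Omega j) - spder j (Omega i)) - Omega i * spder w (Omega j) +
  Omega j * spder w (Omega i) = 0.
Proof.
move=> hi hj; have := (integrableP Omega).1 Omega_int w i j.
rewrite /integrand Omega_w !der_zx // => <-; ring.
Qed.

(* Contraction of the integrability condition with the radial field of z-space. *)
Lemma radial_equation j : j != w ->
  x * (zeuler (Omega j) + Omega j - spder j A - x * spder j B) =
  (A + x * B) * spder w (Omega j) - B * Omega j.
Proof.
move=> hj.
have e1 := sder_zradial Omega hj; have e2 := sder_w_zradial Omega.
rewrite Omega_rad sderD sderM der_zx // mul0r add0r in e1.
rewrite Omega_rad sderD sderM der_wx A_w B_w mul1r mulr0 add0r addr0 in e2.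
have : \sum_(i < N | i != w) svar R N i *
   (x * (spder i (Omega j) - spder j (Omega i)) - Omega i * spder w (Omega j) +
  Omega j * spder w (Omega i)) = 0.
  by rewrite big1 // => i hi; rewrite integrable_w // mulr0.
have -> : \sum_(i < N | i != w) svar R N i *
   (x * (spder i (Omega j) - spder j (Omega i)) - Omega i * spder w (Omega j) +
  Omega j * spder w (Omega i)) =
  x * (zeuler (Omega j) - (\sum_(i < N | i != w) svar R N i * spder j (Omega i))) -
  zradial Omega * spder w (Omega j) +
  Omega j * \sum_(i < N | i != w) svar R N i * spder w (Omega i).
  rewrite zeulerE /zradial mulr_suml mulr_sumr -sumrB mulr_sumr -sumrB -big_split.
  by apply: eq_bigr => i _ /=; ring.
rewrite -e2 Omega_rad.
(* Differentiating the known contraction A + w B along z_j eliminates the derivatives d_j Omega_i,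
   and an equation in Omega_j alone remains. *)
have -> : \sum_(i < N | i != w) svar R N i * spder j (Omega i) =
  spder j A + x * spder j B - Omega j by rewrite e1; ring.
move=> /eqP h; apply/eqP; rewrite -subr_eq0 -(eqP h); apply/eqP; ring.
Qed.

(* Three derivatives of the radial equation in w leave a homogeneous equation for
   the second derivative G, whose right-hand side has larger order in z than G. *)
Lemma Omega_affine j : j != w -> spder w (spder w (Omega j)) = 0.
Proof.
move=> hj; set F := Omega j; set G := spder w (spder w F).
(* E + 1 is made opaque: until the final comparison of coefficients, only its commutation with d/dw
   matters. *)
have [L [LE LD]] : exists L : S -> S, (forall a, L a = zeuler a + a) /\
    forall a, spder w (L a) = L (spder w a).
  by exists (fun a => zeuler a + a); split=> // a; rewrite sderD zeuler_der_w.
have AB i : spder w (spder i A) = 0 /\ spder w (spder i B) = 0.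
  by rewrite [spder w (spder i A)]sder_comm [spder w (spder i B)]sder_comm A_w B_w
    !sder0.
have [dA dB] := AB j.
have h0 : x * (L F - spder j A - x * spder j B) = (A + x * B) * spder w F - B * F.
  by rewrite LE; apply: radial_equation.
have h1 : L F - spder j A - x * spder j B + x * (L (spder w F) - spder j B) = (A +
  x * B) * G.
  have := congr1 (spder w) h0.
  rewrite !(sderM, sderB, sderD) LD dA dB A_w B_w der_wx -/G => h.
  have -> : (A + x * B) * G = (0 + (1 * B + x * 0)) * spder w F + (A +
    x * B) * G - (0 * F + B * spder w F) by ring.
  by rewrite -h; ring.
have h2 : L (spder w F) *+ 2 + x * L G - spder j B *+ 2 = B * G + (A +
  x * B) * spder w G.
  have := congr1 (spder w) h1.
  rewrite !(sderM, sderB, sderD) !LD dA dB A_w B_w der_wx -/G => h.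
  have -> : B * G + (A + x * B) * spder w G =
    (0 + (1 * B + x * 0)) * G + (A + x * B) * spder w G by ring.
  by rewrite -h; ring.
have h3 : L G *+ 3 + x * L (spder w G) = (B * spder w G) *+ 2 + (A +
  x * B) * spder w (spder w G).
  have := congr1 (spder w) h2.
  rewrite !mulr2n !(sderM, sderB, sderD) !LD dB A_w B_w der_wx -/G => h.
  have -> : B * spder w G + B * spder w G + (A + x * B) * spder w (spder w G) =
   0 * G + B * spder w G + ((0 + (1 * B + x * 0)) * spder w G + (A +
     x * B) * spder w (spder w G)) by ring.
  by rewrite -h; ring.
(* The coefficient at m of the left-hand side of [h3] is that of G times (m_w + 3)(zdeg m + 1),
   which is never zero; on the right, A and B raise the order in z. *)
have step k : zorder k G -> zorder k.+1 G.
  have der_order (a : S) : zorder k a -> zorder k (spder w a).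
    by move=> h m hm; rewrite sder_coef h ?mul0rn // zdegD zdegUw addn0.
  move=> hG m hm.
  have : zorder (1 + k) ((B * spder w G) *+ 2 + (A + x * B) * spder w (spder w G)).
    rewrite mulr2n; apply: zorderD.
      by apply: zorderD; apply: zorderM => //; apply: der_order.
    apply: zorderM; last exact: (der_order _ (der_order _ hG)).
    by apply: zorderD => //; apply: zorderMr.
  rewrite -h3 => /(_ m hm) /eqP; rewrite saddE smulrn_coef -LD svar_der_coef -mulrnDr.
  rewrite mulrn_eq0 addSn /= LE saddE /zeuler -mulrSr mulrn_eq0 /=.
  by move/eqP.
have all k : zorder k G by elim: k => [|k ih]; [apply: zorder0 | apply: step].
by apply/funext => m; rewrite (all (zdeg m).+1 m (ltnSn _)).
Qed.

End Affine.
End WFree.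

(** * Assembling the normal form *)

Section NormalForm.
Variables (R : realType) (n : nat).
Local Notation N := n.+1.
Local Notation S := (series R N).
Local Notation w := (@ord_max n).
Local Notation x := (svar R N w).
Local Notation widen := (widen_ord (leqnSn n)).

Lemma of_zE (a : series R n) : of_z a = ssubst a (fun i => svar R N (widen i)).
Proof. by rewrite /of_z scomp_def. Qed.

Lemma normal_formE (f0 f1 : series R n) i :
  normal_form f0 f1 i = spder i (of_z f0) + (x * spder i (of_z f1) + x * spder i x).
Proof. by rewrite /normal_form /dfun /wvar smul_def sder_def. Qed.

Lemma widen_neq i : widen i != w.
Proof. by rewrite -val_eqE /= neq_ltn ltn_ord. Qed.

(** Restriction to w = 0, encoded as a substitution. *)
Definition zrestr_map (i : 'I_N) : series R n := oapp (svar R n) 0 (unlift w i).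
Definition zrestr (f : S) : series R n := ssubst f zrestr_map.

Lemma widen_lift i : widen i = lift w i.
Proof. by apply: val_inj; rewrite /= /bump leqNgt ltn_ord. Qed.

Lemma zrestr_map_w : zrestr_map w = 0.
Proof. by rewrite /zrestr_map unlift_none. Qed.
Lemma zrestr_map_widen i : zrestr_map (widen i) = svar R n i.
Proof. by rewrite /zrestr_map widen_lift liftK. Qed.

Lemma ord_max_or_widen (i : 'I_N) : i = w \/ exists j, i = widen j.
Proof.
by case: (unliftP w i) => [j ->|->]; [right; exists j; rewrite widen_lift | left].
Qed.

Lemma zrestr_order1 : order1 zrestr_map.
Proof.
move=> i; have [->|[j ->]] := ord_max_or_widen i; first by rewrite zrestr_map_w szeroE.
by rewrite zrestr_map_widen svar_coef0.
Qed.

Lemma zrestrK (f : S) : spder w f = 0 -> of_z (zrestr f) = f.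
Proof.
move=> hf; rewrite of_zE /zrestr scompA; last 2 first.
- exact: zrestr_order1.
- by move=> i; rewrite svar_coef0.
have z0 : (0 : S) 0%MM = 0 by [].
rewrite -[RHS](wfree_subst z0 hf); congr (ssubst f _); apply/funext => i.
have [->|[j ->]] := ord_max_or_widen i; first by rewrite zrestr_map_w scomp0 wmap_w.
rewrite zrestr_map_widen scomp_svar ?wmap_z ?widen_neq // => k.
by rewrite svar_coef0.
Qed.

Lemma sder_zrestr (f : S) i : spder i (zrestr f) = zrestr (spder (widen i) f).
Proof.
rewrite /zrestr sder_scomp; last exact: zrestr_order1.
rewrite (bigD1 (widen i)) //= zrestr_map_widen sder_svar eqxx mulr1 big1 ?addr0 // =>
  k hk.
have [->|[j ej]] := ord_max_or_widen k; first by rewrite zrestr_map_w sder0 mulr0.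
move: hk; rewrite ej zrestr_map_widen sder_svar !widen_lift (inj_eq lift_inj).
by rewrite eq_sym => /negPf ->; rewrite mulr0.
Qed.

Lemma convergent_zrestr (f : S) : convergent f -> convergent (zrestr f).
Proof.
move=> cf; apply: convergent_scomp => // [|i]; first exact: zrestr_order1.
have [->|[j ->]] := ord_max_or_widen i; first by rewrite zrestr_map_w;
  apply: convergent0.
by rewrite zrestr_map_widen; apply: convergent_svar.
Qed.

Lemma affine_normalizable (Omega : oneform R N) (A B : S) :
  (forall i, convergent (Omega i)) -> integrable_form Omega -> Omega w = x ->
  spder w A = 0 -> spder w B = 0 -> zorder 1 A -> zorder 1 B ->
  zradial Omega = A + x * B -> normalizable Omega.
Proof.
move=> cO iO Ow A_w B_w A1 B1 Orad.
pose be i : S := spder w (Omega i); pose al i : S := Omega i - x * be i.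
have be_w i : i != w -> spder w (be i) = 0.
  by move=> hi; apply: (Omega_affine iO Ow A_w B_w A1 B1 Orad).
have al_w i : i != w -> spder w (al i) = 0.
  by move=> hi; rewrite /al sderB sderM be_w // der_wx mulr0 addr0 mul1r subrr.
have OE i : Omega i = al i + x * be i by rewrite subrK.
have c_be i : convergent (be i) by apply: convergent_sder.
have c_al i : convergent (al i).
  by apply: convergentB => //; apply: convergentM => //; apply: convergent_svar.
clearbody al; clearbody be.
have key i j : i != w -> j != w ->
  [/\ al i * be j - al j * be i = 0, spder i (al j) = spder j (al i)
    & spder i (be j) = spder j (be i)].
  move=> hi hj; have := integrable_w iO Ow hi hj.
  rewrite (OE i) (OE j) !sderD !sderM (der_zx _ hi) (der_zx _ hj) der_wx.
  rewrite (be_w _ hi) (be_w _ hj) (al_w _ hi) (al_w _ hj).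
  (* A polynomial of degree 2 in w with coefficients free of w, so each coefficient vanishes: these
     are alpha /\ beta, d alpha and d beta. *)
  have -> : x * (spder i (al j) + (0 * be j + x * spder i (be j)) -
      (spder j (al i) + (0 * be i + x * spder j (be i)))) -
      (al i + x * be i) * (0 + (1 * be j + x * 0)) + (al j + x * be j) * (0 +
        (1 * be i + x * 0))
    = - (al i * be j - al j * be i) + x * (spder i (al j) - spder j (al i)) +
      x ^+ 2 * (spder i (be j) - spder j (be i)) by ring.
  have dw k l (F : 'I_N -> S) : (forall i, i != w -> spder w (F i) = 0) -> l != w ->
    spder w (spder k (F l)) = 0 by move=> hF hl; rewrite sder_comm hF // sder0.
  move=> /wfree_poly2 [|||h0 /eqP h1 /eqP h2].
  - by rewrite sderN sderB !sderM !al_w // !be_w // !mul0r !mulr0 !addr0 subrr oppr0.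
  - by rewrite sderB !dw // subrr.
  - by rewrite sderB !dw // subrr.
  split; first by rewrite -[LHS]opprK h0 oppr0.
    by apply/eqP; rewrite -subr_eq0.
  by apply/eqP; rewrite -subr_eq0.
have [F0 [cF0 F0_w dF0]] : exists f : S,
    [/\ convergent f, spder w f = 0 & forall j, j != w -> spder j f = al j].
  by apply: poincare => // i j hi hj; case: (key i j hi hj).
have [F1 [cF1 F1_w dF1]] : exists f : S,
    [/\ convergent f, spder w f = 0 & forall j, j != w -> spder j f = be j].
  by apply: poincare => // i j hi hj; case: (key i j hi hj).
exists (svar R N); split; first exact: germ_biholomorphism_id.
exists (zrestr F0), (zrestr F1), 1; split.
- exact: convergent_zrestr.
- exact: convergent_zrestr.
- exact: convergent1.
- by rewrite sone_coef eqxx oner_neq0.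
split.
  move=> i j; rewrite wedge11E !sder_zrestr !dF0 ?widen_neq // !dF1 ?widen_neq //.
  rewrite /zrestr -!scompM; try exact: zrestr_order1.
  by rewrite -scompB; case: (key (widen i) (widen j));
    rewrite ?widen_neq // => -> _ _; rewrite scomp0.
apply/funext => i; rewrite /scale_form mul1r pullback_id normal_formE !zrestrK //.
have [->|hi] := eqVneq i w; first by rewrite F0_w F1_w Ow der_wx mulr0 add0r add0r
  mulr1.
by rewrite dF0 // dF1 // der_zx // mulr0 addr0 OE.
Qed.

Lemma normalizable_of_w (theta : oneform R N) :
  (forall i, convergent (theta i)) -> integrable_form theta -> theta w = x ->
  normalizable theta.
Proof.
move=> ct it tw; set f := zradial theta.
have cf : convergent f.
  rewrite /f /zradial -big_filter; apply: convergent_sum => i.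
  by apply: convergentM => //; apply: convergent_svar.
have f1 : zorder 1 f := zradial_order theta.
have [v [p [cv v1 vp ev]]] := ck_solution cf f1.
have v0 : v 0%MM = 1.
  have : (v - 1) 0%MM = 0 by apply: v1; rewrite zdeg0.
  by rewrite ssubE sone_coef eqxx => /eqP; rewrite subr_eq0 => /eqP.
pose psi := x * v; pose h := v * spder w psi.
have cpsi : convergent psi by apply: convergentM => //; apply: convergent_svar.
have [|||||phi phi0 [Omega [cO iO Ow Oz [psi_phi hn]]]] :=
    @straighten R n theta psi h ct it cpsi.
- by rewrite /psi smul_coef0 svar_coef0 mul0r.
- by rewrite /psi -[U_(w)%MM]add0m smulX_coef v0 oner_neq0.
- by apply: convergentM => //; apply: convergent_sder.
- by rewrite /h smul_coef0 v0 mul1r der_svar_mul mnm0E v0 oner_neq0.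
- by rewrite tw /h /psi; ring.
have o1 := wmap_order1 phi0.
apply: hn; pose A := atw0 (f * v ^+ 2); pose b := ck_rhs f v p.
pose B := atw0 (wshift b).
have A1 : zorder 1 A by apply: atw0_order; apply: zorderMl.
have b1 : zorder 1 b by apply: ck_rhs_order.
have B1 : zorder 1 B by apply: atw0_order; apply: wshift_order.
have A_w : spder w A = 0 by apply: atw0_der.
have B_w : spder w B = 0 by apply: atw0_der.
apply: (affine_normalizable cO iO Ow A_w B_w A1 B1).
have AE : A = atw0 f * atw0 v ^+ 2 by rewrite /A atw0M expr2 atw0M -expr2.
(* On w = 0 the derivative (w v)' equals v, so this reduces to v p = 1 there. *)
have b0 : atw0 b = 0.
  have AA : atw0 A = A by apply: atw0_id.
  rewrite /b /ck_rhs -AE atw0D atw0N !atw0M atw0_der_svar_mul AA AE.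
  have e : atw0 v * atw0 p = 1 by rewrite -atw0M vp atw0_1.
  have -> : atw0 f * atw0 v - atw0 f * atw0 v ^+ 2 * atw0 p =
    atw0 f * atw0 v * (1 - atw0 v * atw0 p) by ring.
  by rewrite e subrr mulr0.
(* Expansion of [b] in w: no constant term, linear coefficient [B], and remainder E v by the
   equation that v solves. *)
have bE : b = x * B + x ^+ 2 * zeuler v.
  rewrite [LHS]wshiftK b0 add0r [wshift b in LHS]wshiftK -/B ev /wshift2 -/b; ring.
(* Here v b = h f - A, while psi E psi = w^2 v E v because E kills w; the w^2 terms cancel. *)
have key : h * f - psi * zeuler psi = A + psi * B.
  have e1 : v * b = h * f - A * (v * p) by rewrite /b /ck_rhs -AE /h /psi; ring.
  rewrite vp mulr1 in e1.
  have -> : h * f = v * b + A by rewrite e1 subrK.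
  rewrite /psi zeulerM zeuler_svar_w bE; ring.
have -> : zradial Omega = ssubst (h * f - psi * zeuler psi) (wmap phi).
  rewrite /f /zradial zeulerE !mulr_sumr -sumrB scomp_sum; apply: eq_bigr => i hi.
  rewrite Oz // -[svar R N i in LHS](_ : ssubst (svar R N i) (wmap phi) = _).
    by rewrite -scompM //; congr (ssubst _ _); ring.
  by rewrite scomp_svar // wmap_z.
by rewrite key scompD scompM // psi_phi !wfree_subst.
Qed.

(** Taking psi = g and the unit h = dg/dw satisfies h g = psi psi' trivially, which makes the last
    coefficient equal to w. *)
Lemma normalizable_of_transverse (theta : oneform R N) :
  (forall i, convergent (theta i)) -> integrable_form theta ->
  theta w 0%MM = 0 -> theta w U_(w)%MM != 0 -> normalizable theta.
Proof.
move=> ct it t0 t1.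
have [|||phi _ [Omega [cO iO Ow _ [_ hn]]]] :=
    @straighten R n theta (theta w) (spder w (theta w)) ct it (ct w) t0 t1.
- exact: convergent_sder.
- by rewrite sder_coef mnm0E add0m.
- by rewrite mulrC.
by apply: hn; apply: normalizable_of_w.
Qed.

End NormalForm.

(** * Reduction to a first order tangency *)

Section CoordinateChange.
Variables (R : realType) (n : nat).
Local Notation N := n.+1.
Local Notation S := (series R N).
Local Notation w := (@ord_max n).
Local Notation x := (svar R N w).
Implicit Types (theta : oneform R N).

Lemma sder_coef0 (a : S) k : spder k a 0%MM = a U_(k)%MM.
Proof. by rewrite sder_coef add0m mnm0E. Qed.

Lemma sder_ssubst_coef0 (a : S) (Phi : 'I_N -> S) k : order1 Phi ->
  spder k (ssubst a Phi) 0%MM = \sum_l a U_(l)%MM * Phi l U_(k)%MM.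
Proof.
move=> o1; rewrite sder_scomp // ssum_coef; apply: eq_bigr => l _.
by rewrite smul_coef0 scomp_coef0 // !sder_coef0.
Qed.

Lemma normalizable_swap theta (k : 'I_N) :
  normalizable (pullback (fun i => svar R N (tperm k w i)) theta) -> normalizable theta.
Proof.
pose Phi (i : 'I_N) := svar R N (tperm k w i).
have gP : germ_map Phi by move=> i; split;
  [apply: convergent_svar | rewrite /Phi svar_coef0].
have inv : (fun i => ssubst (Phi i) Phi) = svar R N.
  apply/funext => i; rewrite scomp_svar ?/Phi ?tpermK //.
  exact: germ_map_order1.
apply: normalizable_pullback; apply/germ_biholomorphismP; split; first exact: gP.
by exists Phi.
Qed.

Lemma pullback_swap theta (k j : 'I_N) :
  pullback (fun i => svar R N (tperm k w i)) theta j =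
  ssubst (theta (tperm k w j)) (fun i => svar R N (tperm k w i)).
Proof.
rewrite pullbackE (bigD1 (tperm k w j)) //= tpermK sder_svar eqxx mulr1 big1 ?addr0
  // => i hi.
rewrite sder_svar; case: eqP => [e|_]; last by rewrite mulr0.
by move: hi; rewrite e tpermK eqxx.
Qed.

Lemma swap_order1 (k : 'I_N) : order1 (fun i => svar R N (tperm k w i)).
Proof. by move=> i; rewrite svar_coef0. Qed.

Lemma pullback_swap_coef0 theta (k j : 'I_N) :
  pullback (fun i => svar R N (tperm k w i)) theta j 0%MM = theta (tperm k w j) 0%MM.
Proof. by rewrite pullback_swap scomp_coef0 //; apply: swap_order1. Qed.

Lemma pullback_swap_coefU theta (k j l : 'I_N) :
  pullback (fun i => svar R N (tperm k w i)) theta j U_(l)%MM =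
  theta (tperm k w j) U_(tperm k w l)%MM.
Proof.
rewrite pullback_swap -sder_coef0 sder_ssubst_coef0; last exact: swap_order1.
rewrite (bigD1 (tperm k w l)) //= tpermK svar_coef eqxx mulr1 big1 ?addr0 // => i hi.
rewrite svar_coef mnm1_eq; case: eqP => [e|_]; last by rewrite mulr0.
by move: hi; rewrite e tpermK eqxx.
Qed.

Definition shear (b : 'I_N) (P : S) (i : 'I_N) : S :=
  if i == b then svar R N b + P else svar R N i.

Lemma shear_germ b (P : S) : convergent P -> P 0%MM = 0 -> germ_map (shear b P).
Proof.
move=> cP P0 i; rewrite /shear; case: eqP => _.
  split; first by apply: convergentD => //; apply: convergent_svar.
  by rewrite saddE svar_coef0 P0 addr0.
by split; [apply: convergent_svar | rewrite svar_coef0].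
Qed.

Lemma shear_shear b (P Q : S) : b != w -> order1 (shear b Q) ->
  (forall Q : S, order1 (shear b Q) -> ssubst P (shear b Q) = P) -> P + Q = 0 ->
  (fun i => ssubst (shear b P i) (shear b Q)) = svar R N.
Proof.
move=> hb o1 hP hPQ; apply/funext => i; rewrite {1}/shear; case: eqP => [->|/eqP hi].
  by rewrite scompD hP // scomp_svar // /shear eqxx -addrA [Q + P]addrC hPQ addr0.
by rewrite scomp_svar // /shear (negPf hi).
Qed.

(** The shear x_b + lam x_w + c x_w^2 changes the last coefficient into theta_w + (lam + 2 c x_w)
    theta_b, evaluated along the shear. The two conditions on [theta] are its value and its
    w-derivative at 0. *)
Lemma normalizable_shear theta (b : 'I_N) (lam c : R[i]) : b != w ->
  (forall i, convergent (theta i)) -> integrable_form theta ->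
  theta w 0%MM + lam * theta b 0%MM = 0 ->
  theta w U_(w)%MM + lam * theta w U_(b)%MM +
    lam * (theta b U_(w)%MM + lam * theta b U_(b)%MM) + c *+ 2 * theta b 0%MM != 0 ->
  normalizable theta.
Proof.
move=> hb ct it h0 h1; pose P : S := scst lam * x + scst c * x ^+ 2.
have cP : convergent P.
  have cx : convergent x by apply: convergent_svar.
  have cs (d : R[i]) : convergent (scst d : S) by apply: convergent_scst.
  rewrite /P expr2.
  exact: convergentD (convergentM (cs _) cx) (convergentM (cs _) (convergentM cx cx)).
have P0 : P 0%MM = 0 by rewrite /P saddE expr2 !smul_coef0 svar_coef0 !mulr0 addr0.
have xQ (Q : S) : order1 (shear b Q) -> ssubst x (shear b Q) = x.
  by move=> o1; rewrite scomp_svar // /shear eq_sym (negPf hb).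
have hP (Q : S) : order1 (shear b Q) -> ssubst P (shear b Q) = P.
  by move=> o1; rewrite /P expr2 scompD !scompM // !scomp_scst !xQ.
have hNP (Q : S) : order1 (shear b Q) -> ssubst (- P) (shear b Q) = - P.
  by move=> o1; rewrite scompN hP.
have gP : germ_map (shear b P) by apply: shear_germ.
have gN : germ_map (shear b (- P)).
  by apply: shear_germ; [apply: convergentN | rewrite soppE P0 oppr0].
have [oP oN] := (germ_map_order1 gP, germ_map_order1 gN).
have bP : germ_biholomorphism (shear b P).
  apply/germ_biholomorphismP; split=> //; exists (shear b (- P)) => //.
  by split; apply: shear_shear; rewrite ?subrr // addrC subrr.
have dP : spder w P = scst lam + scst (c *+ 2) * x.
  rewrite /P sderD expr2 !sderM !sder_scst der_wx mulr2n scstD; ring.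
have dP0 : spder w P 0%MM = lam.
  by rewrite dP saddE smul_coef0 svar_coef0 mulr0 addr0 scst_coef eqxx.
have pbw : pullback (shear b P) theta w =
    ssubst (theta w) (shear b P) + ssubst (theta b) (shear b P) * spder w P.
  rewrite pullbackE (bigD1 w) //= (bigD1 b) //= big1 => [|l /andP[hl hlb]].
    rewrite {2 4}/shear eq_sym (negPf hb) eqxx sderD der_wx sder_svar eq_sym (negPf hb).
    by rewrite mulr1 add0r addr0.
  by rewrite {2}/shear (negPf hlb) sder_svar eq_sym (negPf hl) mulr0.
apply: (normalizable_pullback bP); apply: normalizable_of_transverse.
- exact: convergent_pullback.
- exact: integrable_pullback.
- by rewrite pbw saddE smul_coef0 !scomp_coef0 // dP0 mulrC.
have subU (a : S) : spder w (ssubst a (shear b P)) 0%MM = a U_(w)%MM + lam * a U_(b)%MM.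
  rewrite sder_ssubst_coef0 // (bigD1 w) //= (bigD1 b) //= big1 => [|l /andP[hl hlb]].
    rewrite /shear eq_sym (negPf hb) eqxx saddE !svar_coef !mnm1_eq eqxx eq_sym
      (negPf hb).
    by rewrite -[P _]sder_coef0 dP0 mulr1 addr0 add0r [lam * _]mulrC.
  by rewrite /shear (negPf hlb) svar_coef mnm1_eq eq_sym (negPf hl) mulr0.
rewrite -sder_coef0 pbw sderD sderM !saddE !smul_coef0 !subU dP0 scomp_coef0 //.
have -> : spder w (spder w P) 0%MM = c *+ 2.
  by rewrite dP sderD sderM !sder_scst der_wx add0r mul0r add0r mulr1 scst_coef eqxx.
by rewrite [_ * lam]mulrC [_ * (c *+ 2)]mulrC addrA.
Qed.

(* The case analysis below is on [theta(0) = 0].  If so, the quadratic form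
   [sum q_ij x_i x_j] of the radial contraction does not vanish identically, and
   a linear change of coordinates makes its [x_w^2] coefficient nonzero; if not,
   one first makes [theta(0)] vanish on [d/dw], and the quadratic shear
   [x_b + c x_w^2] allows to choose that coefficient freely. *)
Lemma normalizable_of_quadratic theta (i j : 'I_N) : (0 < n)%N ->
  (forall i, convergent (theta i)) -> integrable_form theta ->
  theta i U_(j)%MM + theta j U_(i)%MM != 0 -> normalizable theta.
Proof.
move=> hn ct it hq.
have swap_ct k i' := @convergent_pullback R N (fun i => svar R N (tperm k w i)) theta
  (fun i => conj (@convergent_svar R N (tperm k w i)) (@swap_order1 k i)) ct i'.
have swap_it k := @integrable_pullback R N _ theta (@swap_order1 k) it.
have [/existsP [a ha]|] := boolP [exists a, theta a 0%MM != 0]; last first.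
  rewrite negb_exists => /forallP h0.
  have t0 a : theta a 0%MM = 0 by apply/eqP; have := h0 a; rewrite negbK.
  have diag a : theta a U_(a)%MM != 0 -> normalizable theta.
    move=> ha; apply: (@normalizable_swap _ a).
    apply: (normalizable_of_transverse (swap_ct a) (swap_it a)).
      by rewrite pullback_swap_coef0 t0.
    by rewrite pullback_swap_coefU tpermR.
  have [hi|/diag //] := eqVneq (theta i U_(i)%MM) 0.
  have [hj|/diag //] := eqVneq (theta j U_(j)%MM) 0.
  have ij : i != j by apply: contraNneq hq => <-; rewrite hi addr0.
  apply: (@normalizable_swap _ i).
  (* With zero diagonal entries, adding x_w to the coordinate that comes from x_j turns the mixed
     term into a square, whose coefficient is the assumed nonzero sum. *)
  apply: (@normalizable_shear _ (tperm i w j) 1 0 _ (swap_ct i) (swap_it i)).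
  - by rewrite -(inj_eq (@perm_inj _ (tperm i w))) tpermK tpermR eq_sym.
  - by rewrite !pullback_swap_coef0 !t0 mulr0 addr0.
  by rewrite !pullback_swap_coefU !tpermK tpermR hi hj !mul1r mul0rn mul0r !addr0 add0r.
(* The coefficient that is nonzero at 0 must sit at an index other than w, where a shear can use it;
   if it sits at w it is exchanged with that of z_1, present since n > 0. *)
have [b [hb [k hbk]]] : exists b, b != w /\ exists k, theta (tperm k w b) 0%MM != 0.
  have [ea|ne] := eqVneq a w; last by exists a; split=> //; exists w;
    rewrite tperm1 perm1.
  pose b : 'I_N := ord0; have hb : b != w by rewrite -val_eqE /= neq_ltn hn.
  by exists b; split=> //; exists b; rewrite tpermL -ea.
apply: (@normalizable_swap _ k); set th := pullback _ _.
have tb : th b 0%MM != 0 by rewrite /th pullback_swap_coef0.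
pose lam := - th w 0%MM / th b 0%MM.
pose X := th w U_(w)%MM + lam * th w U_(b)%MM + lam * (th b U_(w)%MM +
  lam * th b U_(b)%MM).
(* This c brings the w-derivative to X + (1 - X) = 1. *)
apply: (@normalizable_shear th b lam ((1 - X) / (th b 0%MM *+ 2)) hb (swap_ct k)
  (swap_it k)).
  by rewrite /lam divfK // subrr.
have t2 : th b 0%MM *+ 2 != 0 by rewrite mulrn_eq0.
by rewrite -/X mulrnAl -mulrnAr divfK // addrC subrK oner_neq0.
Qed.

Lemma contract_linear_part theta :
  contract (form_linear_part theta) (radial R N) =
  \sum_i \sum_j scst (theta i U_(j)%MM) * svar R N j * svar R N i.
Proof.
rewrite /contract ssum_def smul_def; apply: eq_bigr => i _.
rewrite -mulr_suml; apply: (congr1 (fun t : S => t * svar R N i)); apply/funext => m.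
rewrite ssum_coef /form_linear_part /linear_part;
  case: eqP => [/eqP/mdeg1P[j /eqP ->]|hm].
  rewrite (bigD1 j) //= scst_mul_coef svar_coef eqxx mulr1 big1 ?addr0 // => k hk.
  by rewrite scst_mul_coef svar_coef mnm1_eq eq_sym (negPf hk) mulr0.
rewrite big1 // => k _; rewrite scst_mul_coef svar_coef; case: eqP => [e|_];
  last by rewrite mulr0.
by move: hm; rewrite e mdeg1.
Qed.

(** Twice the contraction is the sum of the symmetrised coefficients times x_i x_j, so it would
    vanish if all of them did, and 2 is invertible. *)
Lemma quadratic_of_contract theta :
  ~ (contract (form_linear_part theta) (radial R N) =1 szero R N) ->
  exists i j, theta i U_(j)%MM + theta j U_(i)%MM != 0.
Proof.
move=> h; have [/existsP[i /existsP[j hij]]|] :=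
  boolP [exists i, [exists j, theta i U_(j)%MM + theta j U_(i)%MM != 0]];
    first by exists i, j.
rewrite negb_exists => /forallP hq; case: h.
rewrite contract_linear_part; set X := \sum_i _.
suff -> : X = 0 by [].
apply: (@smulrn_eq0 _ _ X 1); rewrite mulr2n {2}/X exchange_big -big_split big1 // =>
  i _ /=.
rewrite -big_split big1 // => j _ /=.
have := hq i; rewrite negb_exists => /forallP /(_ j); rewrite negbK => /eqP hij.
have -> : scst (theta i U_(j)%MM) * svar R N j * svar R N i +
  scst (theta j U_(i)%MM) * svar R N i * svar R N j =
  scst (theta i U_(j)%MM + theta j U_(i)%MM) * svar R N j * svar R N i.
  by rewrite scstD; ring.
by rewrite hij scst0 !mul0r.
Qed.

End CoordinateChange.

Theorem corollary3 (R : realType) (n : nat) (hn : (1 <= n)%N)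
    (Theta : oneform R n.+1)
    (Theta_cvg : forall i, convergent (Theta i))
    (Theta_neq0 : not_identically_zero Theta)
    (Theta_int : integrable_form Theta)
    (Theta_lin : ~ (contract (form_linear_part Theta) (radial R n.+1)
                      =1 szero R n.+1)) :
  exists Phi : 'I_n.+1 -> series R n.+1,
    germ_biholomorphism Phi /\
    exists f0 f1 : series R n,
      [/\ convergent f0, convergent f1,
          (forall i j, wedge11 (dfun f0) (dfun f1) i j =1 szero R n)
        & same_foliation (pullback Phi Theta) (normal_form f0 f1)].
Proof.
have [i [j hij]] := quadratic_of_contract Theta_lin.
have [Phi [bPhi [f0 [f1 [a [c0 c1 ca a0 [hw he]]]]]]] :=
  normalizable_of_quadratic hn Theta_cvg Theta_int hij.
exists Phi; split; first exact: bPhi.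
exists f0, f1; split; [exact: c0 | exact: c1 | exact: hw |].
(* The meromorphic factor is 1/a. *)
exists a, 1; split; [exact: ca | exact: convergent1 | | |].
- by move=> h; move: a0; rewrite h /szero eqxx.
- by move=> /(_ 0%MM); rewrite sone_coef eqxx => /eqP; rewrite oner_eq0.
move=> k m; rewrite smul_def -he.
have e : sprod 1 (scale_form a (pullback Phi Theta) k) = sprod a (pullback Phi Theta k).
  exact: mul1r.
by rewrite e.
Qed.
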